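(* Let $d=2$, $n\in\mathbb N$, $U^n\in\mathbb R^I$, and let $$\tau^*:=\min_{i\in\mathcal V}\frac{m_i}{2\sum_{j\in\mathcal I(i)\setminus\{i\}}d_{ij}(U^n)},\qquad \tau\in\Big(0,\frac{\tau^*}{\Delta c^{\max}}\Big].$$ Consider the $s$-stage IMEX scheme ($s\ge2$): $U^{n,1}:=U^n$; for $l=2,\dots,s+1$, $$\begin{aligned} \mathbb M^LW^{L,l}&=\mathbb M^LU^{n,l-1}-\tau(c_l-c_{l-1})\mathbf F^L(U^{n,l-1}),\\ \mathbb M^HW^{H,l}&=\mathbb M^HU^{n,l-1}-\tau\sum_{k=1}^{l-1}(a^e_{l,k}-a^e_{l-1,k})\mathbf F^H(U^{n,k}),\\ W^{n,l}&=\ell\big(U^{n,l-1},\mathbf F^L(U^{n,l-1}),\mathbf F^H(U^{n,l-1})\big),\\ \mathbb M^HU^{n,l}+\tau\,\mathbf G(U^{n,l})&=\mathbb M^HW^{n,l}-\tau\sum_{k=1}^{l-1}(a^i_{l,k}-a^i_{l-1,k})\mathbf G(U^{n,k}); \end{aligned}$$ and $U^{n+1}:=U^{n,s+1}$. Then: 1. The scheme is well defined, i.e. for each $l\in\{2,\dots,s+1\}$, given $U^{n,1},\dots,U^{n,l-1}$, the four stage-$l$ equations of the scheme (the low-order hyperbolic update for $W^{L,l}$, the high-order hyperbolic update for $W^{H,l}$, the limiter formula for $W^{n,l}$, and the implicit dispersive update for $U^{n,l}$) uniquely determine $W^{L,l},W^{H,l},W^{n,l},U^{n,l}\in\mathbb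 R^I$. 2. The scheme is conservative, i.e. $\sum_{i\in\mathcal V}U_i^{n+1}m_i=\sum_{i\in\mathcal V}U_i^nm_i$.
   Context: Setting. $D=[a,b]^2$ with coordinates $(x,y)$, $\mathbf f:\mathbb R\to\mathbb R^2$ is Lipschitz, $\epsilon>0$, $c>0$ are constants, $(\cdot,\cdot)$ is the $L^2(D)$ inner product. Finite element space. $\mathcal K_h$ is a mesh of $D$ (from a shape-regular family, covering $D$ exactly); $T_K:\hat K\to K$ is the affine map from the reference element; $\hat P$ is the polynomial space of the reference element. $V_h$ is the space of $v\in C^0(D)$, periodic with respect to $D$, with $v|_K\circ T_K\in\hat P$ for all $K\in\mathcal K_h$. $\mathcal V=\{1,\dots,I\}$ enumerates the degrees of freedom and $\{\phi_i\}_{i\in\mathcal V}$ is the basis of global shape functions of $V_h$, with $\sum_{i}\phi_i=1$. A vector $U\in\mathbb R^I$ is identified with $u_h=\sum_iU_i\phi_i\in V_h$. $\mathcal I(i)=\{j\in\mathcal V:\phi_j\phi_i\not\equiv0\}$, $m_i=\int_D\phi_i\,dx$ (assumed $>0$), $m_{ij}=\int_D\phi_i\phi_j\,dx$, $\mathbf c_{ij}=\int_D\phi_i\nabla\phi_j\,dx$, $\mathbf n_{ij}=\mathbf c_{ij}/\|\mathbf c_{ij}\|_{l^2}$ (Euclidean norm). $\mathbb M^L=\mathrm{diag}(m_i)$ is the lumped mass matrix and $\mathbb M^H=(m_{ij})$ the consistent mass matrix. Hyperbolic fluxes. $\lambda_{\max}(\mathbf n,U_L,U_R)$ is an upper bound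 on the maximum wave speed in the one-dimensional Riemann problem $\partial_tu+\partial_x(\mathbf f(u)\cdot\mathbf n)=0$ with left state $U_L$ and right state $U_R$. For $U\in\mathbb R^I$, $$d_{ij}(U)=\max\big(\lambda_{\max}(\mathbf n_{ij},U_i,U_j)\|\mathbf c_{ij}\|_{l^2},\lambda_{\max}(\mathbf n_{ji},U_j,U_i)\|\mathbf c_{ji}\|_{l^2}\big)$$ (a term with $\mathbf c_{ij}=0$ is $0$), and $d^H_{ij}(U)=d_{ij}(U)\max(\psi_i,\psi_j)$, where $(\psi_k)_{k\in\mathcal V}$ are given positive real numbers (which may depend on the state $U$). The maps $\mathbf F^L,\mathbf F^H:\mathbb R^I\to\mathbb R^I$ are $$(\mathbf F^L(U))_i=\sum_{j\in\mathcal I(i)}\big[\mathbf f(U_j)\cdot\mathbf c_{ij}-d_{ij}(U)(U_j-U_i)\big],\qquad(\mathbf F^H(U))_i=\sum_{j\in\mathcal I(i)}\big[\mathbf f(U_j)\cdot\mathbf c_{ij}-d^H_{ij}(U)(U_j-U_i)\big].$$ Limiter. It is assumed that for a bounded interval $[\alpha,\beta]$ there is a map $\ell:[\alpha,\beta]^I\times\mathbb R^I\times\mathbb R^I\to\mathbb R^I$ such that, for $U\in[\alpha,\beta]^I$: (maximum principle) if the low-order update $(\mathbb M^L)^{-1}(\mathbb M^LU-\tau\mathbf F^L(U))$ lies in $[\alpha,\beta]^I$, then $\ell(U,\mathbf F^L(U),\mathbf F^H(U))\in[\alpha,\beta]^I$; (mass conservation) with $V:=\ell(U,\mathbf F^L(U),\mathbf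 F^H(U))$ one has $\sum_{i\in\mathcal V}V_im_i=\sum_{i\in\mathcal V}U_im_i$. Whenever the limiter is applied, $[\alpha,\beta]$ is an interval containing all components of its first argument. Dispersive operator. For $u_h\in V_h$, let $z_h,q_h\in V_h$ satisfy $(z_h-\partial_xu_h,\,c\,s_h-\partial_xs_h)=0$ for all $s_h\in V_h$ and $(q_h-\partial_yu_h,\,c\,r_h-\partial_xr_h)=0$ for all $r_h\in V_h$. The operator $\mathbf G$ is given by $$(\mathbf G(u_h),v_h)=-\epsilon(\partial_xz_h,\partial_xv_h)-\epsilon(\partial_xq_h,\partial_yv_h)-\epsilon c(z_h-\partial_xu_h,\partial_xv_h)-\epsilon c(q_h-\partial_yu_h,\partial_yv_h)\quad\forall v_h\in V_h,$$ and in the scheme $\mathbf G(U)\in\mathbb R^I$ is the vector with entries $(\mathbf G(u_h),\phi_i)$, $u_h=\sum_iU_i\phi_i$. Runge–Kutta coefficients. $(a^e_{l,k})$ are the coefficients of an $s$-stage explicit Runge–Kutta method and $(a^i_{l,k})$ those of an $s$-stage diagonally implicit Runge–Kutta method with explicit first stage, $1\le l\le s+1$, where row $s+1$ contains the final weights. Thus $a^e_{l,k}=0$ for $k\ge l$, $a^i_{l,k}=0$ for $k>l$, $a^i_{1,1}=0$ and $a^i_{s+1,s+1}=0$. The numbers $0=c_1\le c_2\le\dots\le c_s$ and $c_{s+1}=1$ satisfy $\sum_{k=1}^ja^e_{j,k}=\sum_{k=1}^ja^i_{j,k}=c_j$ for $j\in\{1,\dots,s\}$, and $\Delta c^{\max}:=\max_{2\le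 l\le s+1}(c_l-c_{l-1})$. *)

(* Defs.v *)
From mathcomp Require Import all_boot all_order all_algebra.
From mathcomp Require Import all_classical all_reals all_analysis.
Import Order.TTheory GRing.Theory Num.Theory.
Import numFieldNormedType.Exports.

Set Implicit Arguments.
Unset Strict Implicit.
Unset Printing Implicit Defensive.

Local Open Scope classical_set_scope.
Local Open Scope ring_scope.

Notation mu2 := (lebesgue_measure \x lebesgue_measure)%E.

Section PlaneCalculus.
Context {R : realType}.
Implicit Types (p q : R * R) (v : R * R -> R).

Definition dot p q : R := p.1 * q.1 + p.2 * q.2.

(* the Euclidean norm; the library's norm on R * R is the sup norm *)
Definition norm2 p : R := Num.sqrt (dot p p).

Definition pdx v p : R := derive1 (fun x => v (x, p.2)) p.1.
Definition pdy v p : R := derive1 (fun y => v (p.1, y)) p.2.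

End PlaneCalculus.

(* One-dimensional scalar conservation law  d_t u + d_x (g u) = 0.  A point of
   the space-time plane is p = (x, t). *)
Section RiemannProblem.
Context {R : realType}.
Implicit Types (g : R -> R) (u w : R * R -> R).

Definition test_function w : Prop :=
  [/\ continuous w,
      forall p, derivable (fun x => w (x, p.2)) p.1 1 /\
                derivable (fun t => w (p.1, t)) p.2 1,
      continuous (pdx w) /\ continuous (pdy w),
      forall p, 0 <= w p
    & exists M : R, forall p, w p != 0 -> norm2 p <= M].

(* Kruzhkov entropy solution on { t > 0 } with initial datum u0 *)
Definition entropy_solution g (u0 : R -> R) u : Prop :=
  [/\ measurable_fun setT u,
      exists M : R, {ae mu2, forall p, 0 < p.2 -> `|u p| <= M}
    & forall (k : R) w, test_function w ->
        0 <= \int[mu2]_(p in [set p : R * R | 0 < p.2])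
                (`|u p - k| * pdy w p
                 + Num.sg (u p - k) * (g (u p) - g k) * pdx w p)
             + \int[lebesgue_measure]_(x in [set: R]) (`|u0 x - k| * w (x, 0))].

Definition riemann_datum (UL UR : R) : R -> R :=
  fun x => if x < 0 then UL else UR.

(* lam bounds the maximum wave speed: the Riemann fan lies in |x| <= lam * t *)
Definition wave_speed_bound g (UL UR lam : R) : Prop :=
  0 <= lam /\
  forall u, entropy_solution g (riemann_datum UL UR) u ->
    {ae mu2, forall p, 0 < p.2 ->
      (p.1 < - (lam * p.2) -> u p = UL) /\ (lam * p.2 < p.1 -> u p = UR)}.

End RiemannProblem.

(* Reference element: domain and polynomial space.  The polynomial space is
   given by a finite spanning family of bivariate polynomials.  A convex body
   whose affine images tile a square is a polygon (triangle, quadrilateral). *)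
Record ref_element (R : realType) := RefElement {
  ref_dom : set (R * R);
  ref_dom_compact : compact ref_dom;
  ref_dom_convex : @convex_set R (R * R)%type ref_dom;
  ref_dom_interior : ref_dom° !=set0;
  ref_dim : nat;
  ref_poly : 'I_ref_dim -> {poly {poly R}}
}.

Definition ref_space (R : realType) (E : ref_element R) : set (R * R -> R) :=
  [set w | exists coef : 'I_(ref_dim E) -> R, forall p,
    w p = \sum_k coef k * (ref_poly k).[p.1%:P].[p.2]].

Definition affine_map (R : realType) (A : 'M[R]_2) (t p : R * R) : R * R :=
  (A 0 0 * p.1 + A 0 1 * p.2 + t.1, A 1 0 * p.1 + A 1 1 * p.2 + t.2).

Definition square (R : realType) (a b : R) : set (R * R) :=
  `[a, b] `*` `[a, b].

Record mesh (R : realType) (a b : R) (E : ref_element R) := Mesh {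
  ncells : nat;
  cell_mx : 'I_ncells -> 'M[R]_2;
  cell_shift : 'I_ncells -> R * R;
  cell_map := fun k => affine_map (cell_mx k) (cell_shift k);
  cell := fun k => cell_map k @` ref_dom E;
  cell_mx_unit : forall k, cell_mx k \in unitmx;
  mesh_cover : \bigcup_k cell k = square a b;
  mesh_disjoint : forall k l, k != l -> (cell k)° `&` (cell l)° = set0
}.

Arguments cell_map {R a b E} m k p.
Arguments cell {R a b E} m k.

Section FiniteElements.
Context {R : realType} {a b : R} {E : ref_element R} (M : mesh a b E).
Implicit Types (u v z g : R * R -> R).

Definition inner v g : R := \int[mu2]_(p in square a b) (v p * g p).

Definition mesh_interior : set (R * R) := \bigcup_k (cell M k)°.

(* The gradient of a piecewise polynomial function exists off the union of the
   cell boundaries, a null set, on which the representative is set to 0. *)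
Definition dx v : R * R -> R := pdx v \_ mesh_interior.
Definition dy v : R * R -> R := pdy v \_ mesh_interior.

(* Functions are total on R * R, but only their values on the square matter. *)
Definition Vh : set (R * R -> R) :=
  [set v | [/\ {within square a b, continuous v},
    (forall y, a <= y <= b -> v (a, y) = v (b, y)),
    (forall x, a <= x <= b -> v (x, a) = v (x, b))
  & forall k, exists2 w, ref_space E w &
      forall p, ref_dom E p -> v (cell_map M k p) = w p]].

Section Basis.
Context {N : nat} (phi : 'I_N -> R * R -> R).

Definition fe_fun (U : 'cV[R]_N) : R * R -> R :=
  fun p => \sum_i U i 0 * phi i p.

Definition Vh_basis : Prop :=
  (forall i, Vh (phi i)) /\
  forall v, Vh v ->
    exists! U : 'cV[R]_N, forall p, square a b p -> v p = fe_fun U p.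

Definition partition_of_unity : Prop :=
  forall p, square a b p -> \sum_i phi i p = 1.

Definition stencil (i : 'I_N) : {set 'I_N} :=
  finset (fun j =>
    `[< exists2 p, square a b p & phi j p * phi i p != 0 >]).

Definition mass (i : 'I_N) : R := \int[mu2]_(p in square a b) phi i p.

Definition lumped_mass : 'M[R]_N := diag_mx (\row_i mass i).

Definition consistent_mass : 'M[R]_N := \matrix_(i, j) inner (phi i) (phi j).

Definition cvec (i j : 'I_N) : R * R :=
  (inner (phi i) (dx (phi j)), inner (phi i) (dy (phi j))).

Definition nvec (i j : 'I_N) : R * R :=
  ((cvec i j).1 / norm2 (cvec i j), (cvec i j).2 / norm2 (cvec i j)).

Section Hyperbolic.
Context (lam : R * R -> R -> R -> R).

Definition visc (U : 'cV[R]_N) (i j : 'I_N) : R :=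
  Num.max (lam (nvec i j) (U i 0) (U j 0) * norm2 (cvec i j))
          (lam (nvec j i) (U j 0) (U i 0) * norm2 (cvec j i)).

Definition visc_high (psi : 'cV[R]_N -> 'I_N -> R) (U : 'cV[R]_N)
    (i j : 'I_N) : R :=
  visc U i j * Num.max (psi U i) (psi U j).

Definition hyp_flux (f : R -> R * R) (d : 'cV[R]_N -> 'I_N -> 'I_N -> R)
    (U : 'cV[R]_N) : 'cV[R]_N :=
  \col_i \sum_(j in stencil i)
    (dot (f (U j 0)) (cvec i j) - d U i j * (U j 0 - U i 0)).

(* Extended real, since 0^-1 = +oo there: an index i with vanishing
   viscosity sum imposes no restriction on the time step. *)
Definition tau_star (U : 'cV[R]_N) : \bar R :=
  \big[Order.min/+oo%E]_(i < N)
    ((mass i)%:E / (2 * \sum_(j in stencil i | j != i) visc U i j)%:E)%E.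

End Hyperbolic.

Section Dispersive.
Context (eps c : R).

Definition aux_eq g : set (R * R -> R) :=
  [set z | Vh z /\
    forall s, Vh s ->
      inner (fun p => z p - g p) (fun p => c * s p - dx s p) = 0].

(* For c > 0 the solution exists and is unique as a function on the square
   (test with s = z), so the default value of xget is never used. *)
Definition aux g : R * R -> R := xget (fun=> 0) (aux_eq g).

Definition disp_form u v : R :=
  let z := aux (dx u) in
  let q := aux (dy u) in
  - (eps * inner (dx z) (dx v))
  - eps * inner (dx q) (dy v)
  - eps * c * inner (fun p => z p - dx u p) (dx v)
  - eps * c * inner (fun p => q p - dy u p) (dy v).

Definition disp (U : 'cV[R]_N) : 'cV[R]_N :=
  \col_i disp_form (fe_fun U) (phi i).

End Dispersive.

End Basis.
End FiniteElements.

Arguments inner {R} a b v g.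
Arguments partition_of_unity {R} a b {N} phi.
Arguments stencil {R} a b {N} phi i.
Arguments mass {R} a b {N} phi i.
Arguments lumped_mass {R} a b {N} phi.
Arguments consistent_mass {R} a b {N} phi.

Definition in_box (R : realType) (N : nat) (al be : R) (U : 'cV[R]_N) : Prop :=
  forall i, al <= U i 0 <= be.

(* ell al be is the limiter for the interval [al, be]; as a total function it is
   constrained only when its first argument lies in [al, be]^N. *)
Definition limiter (R : realType) (N : nat) (m : 'I_N -> R) (ML : 'M[R]_N)
    (tau : R) (FL FH : 'cV[R]_N -> 'cV[R]_N)
    (ell : R -> R -> 'cV[R]_N -> 'cV[R]_N -> 'cV[R]_N -> 'cV[R]_N) : Prop :=
  forall (al be : R) (U : 'cV[R]_N), in_box al be U ->
    (in_box al be (invmx ML *m (ML *m U - tau *: FL U)) ->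
       in_box al be (ell al be U (FL U) (FH U))) /\
    \sum_i ell al be U (FL U) (FH U) i 0 * m i = \sum_i U i 0 * m i.

(* Indices run from 1; row s.+1 holds the final weights. *)
Record imex_tableau (R : realType) (s : nat) := ImexTableau {
  ae : nat -> nat -> R;
  ai : nat -> nat -> R;
  node : nat -> R;
  ae_explicit : forall l k, (1 <= l)%N -> (l <= k <= s.+1)%N -> ae l k = 0;
  ai_lower : forall l k, (1 <= l)%N -> (l < k <= s.+1)%N -> ai l k = 0;
  ai_first : ai 1 1 = 0;
  ai_last : ai s.+1 s.+1 = 0;
  node_first : node 1 = 0;
  node_mono : forall l, (1 <= l < s)%N -> node l <= node l.+1;
  node_last : node s.+1 = 1;
  ae_sum : forall j, (1 <= j <= s)%N -> \sum_(1 <= k < j.+1) ae j k = node j;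
  ai_sum : forall j, (1 <= j <= s)%N -> \sum_(1 <= k < j.+1) ai j k = node j
}.

Definition dc_max (R : realType) (s : nat) (T : imex_tableau R s) : R :=
  \big[Num.max/node T 2 - node T 1]_(2 <= l < s.+2) (node T l - node T l.-1).

(* The four equations of stage l.  U k is the k-th stage vector, used only for
   1 <= k < l; the unknowns are WL, WH, W and Ul. *)
Definition imex_stage (R : realType) (N s : nat) (T : imex_tableau R s)
    (ML MH : 'M[R]_N) (FL FH G : 'cV[R]_N -> 'cV[R]_N)
    (ell : 'cV[R]_N -> 'cV[R]_N -> 'cV[R]_N -> 'cV[R]_N) (tau : R)
    (l : nat) (U : nat -> 'cV[R]_N) (WL WH W Ul : 'cV[R]_N) : Prop :=
  [/\ ML *m WL = ML *m U l.-1 - (tau * (node T l - node T l.-1)) *: FL (U l.-1),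
      MH *m WH = MH *m U l.-1
        - tau *: \sum_(1 <= k < l) (ae T l k - ae T l.-1 k) *: FH (U k),
      W = ell (U l.-1) (FL (U l.-1)) (FH (U l.-1))
    & MH *m Ul + tau *: G Ul = MH *m W
        - tau *: \sum_(1 <= k < l) (ai T l k - ai T l.-1 k) *: G (U k)].

(* Main.v *)
Require Import Defs.
From mathcomp Require Import all_boot all_order all_algebra.
From mathcomp Require Import all_classical all_reals all_analysis.
From mathcomp Require Import measurable_realfun ring lra.
Import Order.TTheory GRing.Theory Num.Theory.
Import numFieldNormedType.Exports.
Set Implicit Arguments.
Unset Strict Implicit.
Unset Printing Implicit Defensive.
Local Open Scope classical_set_scope.
Local Open Scope ring_scope.

(** Both claims reduce to the implicit dispersive stage.

    Write [G] for the dispersive operator and [u] for a finite element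
    function, with auxiliary functions [z] and [q]. Testing the equation of
    [z] with [z] itself and using that a periodic finite element function is
    L2-orthogonal to its own x-derivative ([inner_dx_self]) gives the energy
    identity ([aux_energy], [disp_form_ge0])

      [(G u, u) = eps * c * (|z - dx u|^2 + |q - dy u|^2) >= 0],

    the norms being those of L2. The second auxiliary equation is also tested
    with an x-derivative, so the same orthogonality serves for [q]. Hence
    [M^H + tau G] is injective: a solution of the homogeneous equation has
    zero L2 norm, hence vanishes on the square by continuity ([inner_eq0]).
    As [G] is linear, a fact that rests on the unique solvability of the
    auxiliary problems (again by the orthogonality, [tst_definite]), the
    implicit equation is a square linear system and has exactly one solution
    ([implicit_bij]). The two explicit updates only invert mass matrices, and
    the limiter equation is a formula.

    For conservation, summing the components of the implicit equation amounts
    to testing with the constant 1, the sum of the shape functions. The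
    dispersive terms then vanish because each contains a derivative of the
    test function ([disp_total]), while the consistent and the lumped mass
    matrix give the same total ([mass_total]). So each stage has the mass of
    the limited state, which is that of the preceding stage.

    The analytic content is the orthogonality [(z, dx z) = 0]. The cells are
    convex, so all but finitely many horizontal lines meet the cell boundaries
    in finitely many points ([mesh_slice_finite]). Along such a line
    [z ^+ 2 / 2] is continuous, has derivative [z * dx z] off a finite set and
    takes equal values at the two ends, so [z * dx z] integrates to zero;
    Fubini's theorem concludes. *)

(** * Linear systems and measurability in the plane *)

Section LinAlg.
Variables (F : fieldType) (n : nat) (L : 'cV[F]_n -> 'cV[F]_n).
Hypothesis L_lin : forall k u v, L (k *: u + v) = k *: L u + L v.

(** The form in which finite dimension enters: every discrete problem below is
    a square linear system, given as a map rather than as a matrix, so that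
    its solvability reduces to the uniqueness of the homogeneous solution,
    which an energy estimate can give. *)
Lemma linear_inj_bij : (forall u, L u = 0 -> u = 0) ->
  forall w, exists! u, L u = w.
Proof.
move=> inj.
have L0 : L 0 = 0 by have := L_lin (-1) 0 0; rewrite scaler0 addr0 scaleN1r addNr.
have LB u v : L (u - v) = L u - L v.
  by rewrite addrC -scaleN1r L_lin scaleN1r addrC.
pose A : 'M[F]_n := \matrix_(i, j) L (delta_mx j 0) i 0.
have LA u : L u = A *m u.
  have Lsum (I : Type) (r : seq I) (k : I -> F) (v : I -> 'cV[F]_n) :
      L (\sum_(i <- r) k i *: v i) = \sum_(i <- r) k i *: L (v i).
    by elim: r => [|i r IH]; rewrite ?big_nil// !big_cons L_lin IH.
  rewrite [u in L u]matrix_sum_delta.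
  under eq_bigr do rewrite big_ord1.
  rewrite Lsum; apply/matrixP => i j; rewrite (ord1 j) summxE !mxE.
  by apply: eq_bigr => k _; rewrite !mxE mulrC.
have uA : A \in unitmx.
  rewrite -unitmx_tr unitmxE unitfE; apply/negP => /det0P[v v0 vA].
  move/negP: v0; apply; apply/eqP/trmx_inj; rewrite trmx0; apply: inj.
  by rewrite LA -[A]trmxK -trmx_mul vA trmx0.
move=> w; exists (invmx A *m w); split.
  by rewrite LA mulmxA mulmxV// mul1mx.
by move=> u; rewrite LA => <-; rewrite mulmxA mulVmx// mul1mx.
Qed.
End LinAlg.

Section OpenMeas.
Variable R : realType.

(** The product sigma-algebra contains the open sets of the plane because
    those are countable unions of boxes with rational corners. *)
Lemma open_measurable2 (O : set (R * R)) : open O -> measurable O.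
Proof.
move=> oO.
pose box (r : (rat * rat) * (rat * rat)) : set (R * R) :=
  `]ratr r.1.1, ratr r.1.2[ `*` `]ratr r.2.1, ratr r.2.2[.
pose F r := if pselect (box r `<=` O) then box r else set0.
have -> : O = \bigcup_r F r.
  apply/seteqP; split => [[x y] Oxy|p [r _]]; last first.
    by rewrite /F; case: pselect => // rO; exact: rO.
  move: oO; rewrite openE => /(_ _ Oxy) /nbhs_ballP[e /= e0 eO].
  have rat_near (z : R) : exists l u : rat,
     [/\ z - e < ratr l, ratr l < z, z < ratr u & ratr u < z + e].
    have /rat_in_itvoo[l] : z - e < z by rewrite ltrBlDr ltrDl.
    have /rat_in_itvoo[u] : z < z + e by rewrite ltrDl.
    by rewrite !in_itv/= => /andP[? ?] /andP[? ?]; exists l, u.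
  have [lx [ux [? ? ? ?]]] := rat_near x.
  have [ly [uy [? ? ? ?]]] := rat_near y.
  exists ((lx, ux), (ly, uy)) => //; rewrite /F.
  have box_ball z l u t : z - e < l -> u < z + e -> l < t -> t < u -> ball z e t.
    move=> h1 h2 h3 h4; rewrite -ball_normE /= ltr_distlC.
    by rewrite (lt_trans h1 h3) (lt_trans h4 h2).
  have sub : box ((lx, ux), (ly, uy)) `<=` O; last first.
    case: (pselect _) => [inO|notO]; last by case: notO.
    by split => /=; rewrite in_itv/=; apply/andP.
  move=> [s t] [/=]; rewrite !in_itv/= => /andP[? ?] /andP[? ?].
  by apply: eO; split => /=; apply: box_ball; eassumption.
apply: countable_bigcupT_measurable; first exact: countableP.
move=> r; rewrite /F; case: (pselect _) => [inO|notO].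
  exact: measurableX.
exact: measurable0.
Qed.
End OpenMeas.

(** * Bounded measurable functions on the square *)

Section BoundedMeasurable.
Variables (R : realType) (a b : R).
Local Notation D := (square a b).

Lemma measurable_square : measurable D.
Proof. exact: measurableX. Qed.

Lemma square_lty : (mu2 D < +oo)%E.
Proof.
rewrite /square product_measure1E//= !lebesgue_measure_itv/=.
by case: ifP; rewrite ?mul0e ?ltry// -EFinB -EFinM ltry.
Qed.

(** The integrands of the scheme all lie in this class. It is stable under
    sums and products, contains the discontinuous piecewise gradients, and on
    the square boundedness gives integrability, so that [inner] is bilinear
    on it without further side conditions. *)
Definition bmeas (v : R * R -> R) : Prop :=
  measurable_fun D v /\ exists K, forall p, D p -> `|v p| <= K.

Lemma bmeas_cst k : bmeas (fun=> k).
Proof. by split=> //; exists `|k|. Qed.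

Lemma bmeasD u v : bmeas u -> bmeas v -> bmeas (fun p => u p + v p).
Proof.
move=> [mu [K uK]] [mv [L vL]]; split; first exact: measurable_funD.
exists (K + L) => p Dp; rewrite (le_trans (ler_normD _ _))//.
by rewrite lerD ?uK ?vL.
Qed.

Lemma bmeasM u v : bmeas u -> bmeas v -> bmeas (fun p => u p * v p).
Proof.
move=> [mu [K uK]] [mv [L vL]]; split; first exact: measurable_funM.
by exists (K * L) => p Dp; rewrite normrM ler_pM ?uK ?vL.
Qed.

Lemma bmeasZ k u : bmeas u -> bmeas (fun p => k * u p).
Proof. exact/bmeasM/bmeas_cst. Qed.

Lemma bmeasB u v : bmeas u -> bmeas v -> bmeas (fun p => u p - v p).
Proof.
move=> bu bv; have := bmeasD bu (bmeasZ (-1) bv).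
by congr bmeas; apply/funext => p; rewrite mulN1r.
Qed.

Lemma bmeas_within u : {within D, continuous u} -> bmeas u.
Proof.
move=> cu; split.
  apply: (measurability _ (RGenOpens.measurableE R)).
  move=> _ [_ [x [y ->] <-]].
  have /open_subspaceP[V oV VD] : open (u @^-1` `]x, y[ : set (subspace D)).
    by move/continuousP : cu; apply; exact: interval_open.
  rewrite setIC -VD; apply: measurableI; last exact: measurable_square.
  exact: open_measurable2.
have /compact_bounded[K [_ uK]] : compact (u @` D).
  by apply: continuous_compact => //; apply: compact_setX; exact: segment_compact.
exists (K + 1) => p Dp; apply: (uK (K + 1)); first by rewrite ltrDl.
by exists p.
Qed.

Lemma bmeas_integrable u : bmeas u -> mu2.-integrable D (EFin \o u).
Proof.
move=> [mu [K uK]]; apply: measurable_bounded_integrable => //.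
- exact: measurable_square.
- exact: square_lty.
- exists K; split; first exact: num_real.
  by move=> x Kx p Dp; exact: le_trans (uK _ Dp) (ltW Kx).
Qed.

Lemma inner_sym u v : inner a b u v = inner a b v u.
Proof. by apply: eq_Rintegral => p _; rewrite mulrC. Qed.

Lemma eq_inner u v u' v' : {in D, u =1 u'} -> {in D, v =1 v'} ->
  inner a b u v = inner a b u' v'.
Proof. by move=> uu' vv'; apply: eq_Rintegral => p Dp; rewrite uu'// vv'. Qed.

Lemma innerPl k u v w : bmeas u -> bmeas v -> bmeas w ->
  inner a b (fun p => k * u p + v p) w = k * inner a b u w + inner a b v w.
Proof.
move=> bu bv bw; rewrite /inner -RintegralZl; last 2 first.
  exact: measurable_square.
  exact/bmeas_integrable/bmeasM.
rewrite -RintegralD; last 3 first.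
  exact: measurable_square.
  by apply: bmeas_integrable; apply: bmeasZ; exact: bmeasM.
  exact/bmeas_integrable/bmeasM.
by apply: eq_Rintegral => p _; rewrite mulrDl mulrA.
Qed.

Lemma innerPr k u v w : bmeas u -> bmeas v -> bmeas w ->
  inner a b w (fun p => k * u p + v p) = k * inner a b w u + inner a b w v.
Proof. by move=> *; rewrite inner_sym innerPl// !(inner_sym w). Qed.

Lemma innerBl u v w : bmeas u -> bmeas v -> bmeas w ->
  inner a b (fun p => u p - v p) w = inner a b u w - inner a b v w.
Proof.
move=> bu bv bw; have := innerPl (-1) bv bu bw.
rewrite mulN1r [RHS]addrC => <-; apply: eq_inner => // p _.
by rewrite mulN1r addrC.
Qed.

Lemma inner0l w : inner a b (fun=> 0) w = 0.
Proof. by rewrite /inner /Rintegral integral0_eq//= => p _; rewrite mul0r. Qed.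

Lemma innerZl k u w : bmeas u -> bmeas w ->
  inner a b (fun p => k * u p) w = k * inner a b u w.
Proof.
move=> bu bw; have := innerPl k bu (bmeas_cst 0) bw.
rewrite inner0l addr0 => <-; apply: eq_inner => // p _; by rewrite addr0.
Qed.

Lemma innerZr k u w : bmeas u -> bmeas w ->
  inner a b w (fun p => k * u p) = k * inner a b w u.
Proof. by move=> *; rewrite inner_sym innerZl// inner_sym. Qed.

Lemma innerBr u v w : bmeas u -> bmeas v -> bmeas w ->
  inner a b w (fun p => u p - v p) = inner a b w u - inner a b w v.
Proof. by move=> *; rewrite inner_sym innerBl// !(inner_sym w). Qed.

Lemma inner_ge0 u : 0 <= inner a b u u.
Proof. by apply: Rintegral_ge0 => p _; rewrite -expr2 sqr_ge0. Qed.

Hypothesis ab : a < b.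

(** Also at an endpoint of [a, b] there is room for a nondegenerate
    subinterval; this makes a relative neighbourhood of a boundary point of
    the square have positive measure. *)
Lemma subitv_ball t e : 0 < e -> a <= t <= b -> exists l r,
  [/\ l < r, a <= l, r <= b & forall z, l <= z <= r -> ball t e z].
Proof.
move=> e0 /andP[at_ tb]; have e2 : 0 < e / 2 by rewrite divr_gt0.
exists (Num.max a (t - e / 2)), (Num.min b (t + e / 2)); split.
- by rewrite gt_max !lt_min; apply/andP; split; apply/andP; split=> //; lra.
- by rewrite le_max lexx.
- by rewrite ge_min lexx.
move=> z; rewrite ge_max le_min => /andP[/andP[_ h1] /andP[_ h2]].
by rewrite -ball_normE /= ltr_distlC; apply/andP; split; lra.
Qed.

(** If [u] did not vanish at [p], then [u ^+ 2] would exceed a positive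
    constant on a nondegenerate box inside the square. *)
Lemma inner_eq0 u : {within D, continuous u} -> inner a b u u = 0 ->
  forall p, D p -> u p = 0.
Proof.
move=> cu iu p Dp; apply/eqP; rewrite -[_ == _]negbK; apply/negP => up0.
have bu := bmeas_within cu.
pose d := `|u p| / 2.
have d0 : 0 < d by rewrite divr_gt0// normr_gt0.
have [e e0 eu] : exists2 e, 0 < e & forall q, D q -> ball p e q -> d <= `|u q|.
  have /cvgrPdist_lt/(_ _ d0) : u q @[q --> within D (nbhs p)] --> u p.
    by have /subspace_continuousP := cu; exact.
  rewrite near_withinE => /nbhs_ballP[e /= e0 He]; exists e => // q Dq pq.
  have /ltW := He _ pq Dq.
  rewrite -(lerD2l (`|u q|)) => h.
  have : `|u p| <= `|u q| + `|u p - u q|.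
    by rewrite -[leLHS]/(`|u p|) -{1}(subrK (u q) (u p)) addrC ler_normD.
  by move=> /le_trans/(_ h); rewrite {1}(splitr `|u p|) -/d lerD2r.
have [Dp1 Dp2] : a <= p.1 <= b /\ a <= p.2 <= b.
  by case: Dp; rewrite /= !in_itv.
have [l1 [r1 [lr1 al1 rb1 lrp1]]] := subitv_ball e0 Dp1.
have [l2 [r2 [lr2 al2 rb2 lrp2]]] := subitv_ball e0 Dp2.
pose B : set (R * R) := `[l1, r1] `*` `[l2, r2].
have mB : measurable B by exact: measurableX.
have muB : mu2 B = ((r1 - l1) * (r2 - l2))%:E.
  by rewrite product_measure1E//= !lebesgue_measure_itv/= !lte_fin lr1 lr2 -!EFinB -EFinM.
have BD : B `<=` D.
  move=> [x y] [/=]; rewrite !in_itv/= => /andP[h1 h2] /andP[h3 h4].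
  split => /=; rewrite in_itv/=; apply/andP; split.
  - exact: le_trans al1 h1.
  - exact: le_trans h2 rb1.
  - exact: le_trans al2 h3.
  - exact: le_trans h4 rb2.
have : ((d ^+ 2)%:E * mu2 B <= \int[mu2]_(p in D) (u p * u p)%:E)%E.
  rewrite -integral_cst//.
  apply: (@le_trans _ _ (\int[mu2]_(p in B) (u p * u p)%:E)%E).
    apply: ge0_le_integral => //.
    - by move=> q ?; rewrite lee_fin sqr_ge0.
    - apply/measurable_EFinP; apply: (measurable_funS measurable_square BD).
      exact: (bmeasM bu bu).1.
    move=> q Bq; rewrite lee_fin -expr2 -(real_normK (num_real (u q))).
    rewrite lerXn2r ?nnegrE// ?(ltW d0)//; apply: eu; first exact: BD.
    case: q Bq => x y [/=]; rewrite !in_itv/= => ? ?.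
    by split; [exact: lrp1|exact: lrp2].
  apply: ge0_subset_integral => //.
  - exact: measurable_square.
  - by apply/measurable_EFinP; exact: (bmeasM bu bu).1.
  - by move=> q _; rewrite lee_fin -expr2 sqr_ge0.
have -> : (\int[mu2]_(p in D) (u p * u p)%:E)%E = (inner a b u u)%:E.
  rewrite /inner /Rintegral fineK//; apply: integrable_fin_num.
    exact: measurable_square.
  exact: (bmeas_integrable (bmeasM bu bu)).
rewrite iu muB -EFinM lee_fin; apply/negP; rewrite -ltNge.
apply: mulr_gt0; first exact: exprn_gt0.
by apply: mulr_gt0; rewrite subr_gt0.
Qed.

End BoundedMeasurable.

(** * Continuously differentiable functions of the plane *)

Section C1.
Variable R : realType.
Implicit Types w : R * R -> R.

(** A class that contains the polynomial functions composed with affine maps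
    and is seen to do so by closure under sums and products alone, without a
    chain rule. *)
Definition c1 w : Prop :=
  [/\ continuous w,
      forall p, derivable (fun x => w (x, p.2)) p.1 1,
      forall p, derivable (fun y => w (p.1, y)) p.2 1
    & continuous (pdx w) /\ continuous (pdy w)].

Lemma c1_ext w w' : w =1 w' -> c1 w -> c1 w'.
Proof. by move=> /funext ->. Qed.

Lemma c1_cst k : c1 (fun=> k).
Proof.
split.
- by move=> p; exact: cvg_cst.
- by move=> p; exact: derivable_cst.
- by move=> p; exact: derivable_cst.
have -> : pdx (fun=> k) = fun=> 0 by apply/funext => p; rewrite /pdx derive1_cst.
have -> : pdy (fun=> k) = fun=> 0 by apply/funext => p; rewrite /pdy derive1_cst.
by split=> p; exact: cvg_cst.
Qed.

Lemma c1_fst : c1 fst.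
Proof.
split.
- by move=> p; exact: cvg_fst.
- by move=> p; exact: derivable_id.
- by move=> p; exact: derivable_cst.
have -> : pdx (@fst R R) = fun=> 1.
  by apply/funext => p; rewrite /pdx /= derive1E derive_id.
have -> : pdy (@fst R R) = fun=> 0 by apply/funext => p; rewrite /pdy derive1_cst.
by split=> p; exact: cvg_cst.
Qed.

Lemma c1_snd : c1 snd.
Proof.
split.
- by move=> p; exact: cvg_snd.
- by move=> p; exact: derivable_cst.
- by move=> p; exact: derivable_id.
have -> : pdy (@snd R R) = fun=> 1.
  by apply/funext => p; rewrite /pdy /= derive1E derive_id.
have -> : pdx (@snd R R) = fun=> 0 by apply/funext => p; rewrite /pdx derive1_cst.
by split=> p; exact: cvg_cst.
Qed.

Lemma c1D v w : c1 v -> c1 w -> c1 (fun p => v p + w p).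
Proof.
move=> [cv vx vy [cvx cvy]] [cw wx wy [cwx cwy]]; split.
- by move=> p; apply: cvgD; [exact: cv|exact: cw].
- by move=> p; exact: derivableD.
- by move=> p; exact: derivableD.
have -> : pdx (fun p => v p + w p) = fun p => pdx v p + pdx w p.
  by apply/funext => p; rewrite /pdx !derive1E deriveD.
have -> : pdy (fun p => v p + w p) = fun p => pdy v p + pdy w p.
  by apply/funext => p; rewrite /pdy !derive1E deriveD.
by split=> p; apply: cvgD; [exact: cvx|exact: cwx|exact: cvy|exact: cwy].
Qed.

Lemma c1M v w : c1 v -> c1 w -> c1 (fun p => v p * w p).
Proof.
move=> [cv vx vy [cvx cvy]] [cw wx wy [cwx cwy]]; split.
- by move=> p; apply: cvgM; [exact: cv|exact: cw].
- by move=> p; exact: derivableM.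
- by move=> p; exact: derivableM.
have -> : pdx (fun p => v p * w p) = fun p => v p * pdx w p + w p * pdx v p.
  by apply/funext => -[x y]; rewrite /pdx !derive1E deriveM.
have -> : pdy (fun p => v p * w p) = fun p => v p * pdy w p + w p * pdy v p.
  by apply/funext => -[x y]; rewrite /pdy !derive1E deriveM.
by split=> p; apply: cvgD; apply: cvgM;
  [exact: cv|exact: cwx|exact: cw|exact: cvx|exact: cv|exact: cwy|exact: cw|exact: cvy].
Qed.

Lemma c1_sum n (v : 'I_n -> R * R -> R) : (forall i, c1 (v i)) ->
  c1 (fun p => \sum_i v i p).
Proof.
move=> cv; elim: (index_enum _) => [|i r IH].
  by apply: c1_ext (c1_cst 0) => p; rewrite big_nil.
by apply: c1_ext (c1D (cv i) IH) => p; rewrite big_cons.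
Qed.

Lemma c1_horner (q : {poly R}) w : c1 w -> c1 (fun p => q.[w p]).
Proof.
move=> cw; elim/poly_ind: q => [|q c IH].
  by apply: c1_ext (c1_cst 0) => p; rewrite horner0.
by apply: c1_ext (c1D (c1M IH cw) (c1_cst c)) => p; rewrite hornerMXaddC.
Qed.

Lemma c1_horner2 (q : {poly {poly R}}) v w : c1 v -> c1 w ->
  c1 (fun p => q.[(v p)%:P].[w p]).
Proof.
move=> cv cw; elim/poly_ind: q => [|q c IH].
  by apply: c1_ext (c1_cst 0) => p; rewrite !horner0.
apply: c1_ext (c1D (c1M IH cv) (c1_horner c cw)) => p.
by rewrite hornerMXaddC hornerD hornerM hornerC.
Qed.

Lemma c1_affine (al be ga : R) : c1 (fun p => al * p.1 + be * p.2 + ga).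
Proof.
apply: c1D (c1_cst _); apply: c1D.
  exact: c1M (c1_cst _) c1_fst.
exact: c1M (c1_cst _) c1_snd.
Qed.

Lemma c1_ref_space (E : ref_element R) w v1 v2 : ref_space E w ->
  c1 v1 -> c1 v2 -> c1 (fun p => w (v1 p, v2 p)).
Proof.
move=> [coef wE] c1v c2v.
apply: (@c1_ext (fun p => \sum_k coef k * (ref_poly k).[(v1 p)%:P].[v2 p])).
  by move=> p; rewrite wE.
by apply: c1_sum => k; apply: c1M (c1_cst _) _; exact: c1_horner2.
Qed.

End C1.

(** * Slices of planar convex sets *)

Section Convex.
Variable R : realType.
Implicit Types (A K : set (R * R)) (p q : R * R).

Definition segpt (t : R) p q : R * R :=
  (t * p.1 + (1 - t) * q.1, t * p.2 + (1 - t) * q.2).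

Definition plane_convex A : Prop :=
  forall p q t, 0 <= t <= 1 -> A p -> A q -> A (segpt t p q).

Lemma convex_set_plane (A : set (R * R)) :
  @convex_set R (R * R)%type A -> plane_convex A.
Proof.
move=> cA p q t t01 Ap Aq.
have i01 : Itv.spec (@Itv.num_sem R) (Itv.Real `[0%Z, 1%Z]) t.
  by rewrite /Itv.spec/= /Itv.num_sem/= num_real/= in_itv/=.
have := cA p q (Itv.mk i01); rewrite !inE => /(_ Ap Aq).
by [].
Qed.

Lemma plane_interiorP A p : A° p <-> exists2 r, 0 < r &
  forall q, `|q.1 - p.1| < r -> `|q.2 - p.2| < r -> A q.
Proof.
rewrite /interior /=; split.
  move=> /nbhs_ballP[r /= r0 rA]; exists r => // q q1 q2; apply: rA.
  by split; rewrite -ball_normE /= distrC.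
move=> [r r0 rA]; apply/nbhs_ballP; exists r => //= q [q1 q2].
by apply: rA; rewrite distrC; move: q1 q2; rewrite -!ball_normE.
Qed.

(** The homothety of centre [q] and ratio [t] maps a neighbourhood of [p]
    contained in the convex set onto a neighbourhood of the point [segpt t p q]. *)
Lemma convex_interior A p q t : plane_convex A -> A° p -> A q ->
  0 < t <= 1 -> A° (segpt t p q).
Proof.
move=> cA /plane_interiorP[r r0 rA] Aq /andP[t0 t1].
apply/plane_interiorP; exists (t * r); first exact: mulr_gt0.
move=> z /= z1 z2.
(* the preimage of [z] under the homothety of centre [q] and ratio [t] *)
pose p' := ((z.1 - (1 - t) * q.1) / t, (z.2 - (1 - t) * q.2) / t).
have -> : z = segpt t p' q.
  case: z {z1 z2} @p' => x y /=; rewrite /segpt /=.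
  by congr (_, _); field; rewrite gt_eqF.
apply: cA => //; first by rewrite (ltW t0).
apply: rA => /=.
  rewrite -(ltr_pM2l t0) -{1}(gtr0_norm t0) -normrM.
  by apply: le_lt_trans z1; rewrite le_eqVlt; apply/orP; left; apply/eqP;
    congr `| _ |; field; rewrite gt_eqF.
rewrite -(ltr_pM2l t0) -{1}(gtr0_norm t0) -normrM.
by apply: le_lt_trans z2; rewrite le_eqVlt; apply/orP; left; apply/eqP;
  congr `| _ |; field; rewrite gt_eqF.
Qed.

Lemma between_conv (x0 x x' : R) : x0 < x < x' \/ x' < x < x0 ->
  exists2 t, 0 < t <= 1 & x = t * x0 + (1 - t) * x'.
Proof.
move=> h; have x0x' : x' - x0 != 0.
  by apply/eqP => e; case: h => /andP[? ?]; lra.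
exists ((x' - x) / (x' - x0)); last by field.
case: h => /andP[h1 h2].
  have d : 0 < x' - x0 by lra.
  by apply/andP; split; [apply: divr_gt0; lra|rewrite ler_pdivrMr//; lra].
have d : 0 < x0 - x' by lra.
have -> : (x' - x) / (x' - x0) = (x - x') / (x0 - x').
  by field; rewrite x0x' gt_eqF.
by apply/andP; split; [apply: divr_gt0; lra|rewrite ler_pdivrMr//; lra].
Qed.

Lemma at_most_one_list (T : choiceType) (P : T -> Prop) :
  (forall x x', P x -> P x' -> x = x') ->
  exists s : seq T, forall x, P x -> x \in s.
Proof.
move=> Puniq; have [[x Px]|nP] := pselect (exists x, P x).
  by exists [:: x] => x' Px'; rewrite (Puniq x' x)// mem_head.
by exists [::] => x Px; case: nP; exists x.
Qed.

(** On each side of [x0] two distinct points satisfying [P] cannot coexist,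
    since the one closer to [x0] lies between [x0] and the other. *)
Lemma two_sided_list (P : R -> Prop) (x0 : R) : ~ P x0 ->
  (forall x x', x0 < x < x' \/ x' < x < x0 -> P x' -> ~ P x) ->
  exists s : seq R, forall x, P x -> x \in s.
Proof.
move=> nP0 between.
have [s1 s1P] : exists s : seq R, forall x, (x0 < x) /\ P x -> x \in s.
  apply: at_most_one_list => x x' [x0x Px] [x0x' Px'].
  have [xx'|x'x|//] := ltgtP x x'.
    by case: (between x x') => //; left; rewrite x0x.
  by case: (between x' x) => //; left; rewrite x0x'.
have [s2 s2P] : exists s : seq R, forall x, (x < x0) /\ P x -> x \in s.
  apply: at_most_one_list => x x' [x0x Px] [x0x' Px'].
  have [xx'|x'x|//] := ltgtP x x'.
    by case: (between x' x) => //; right; rewrite xx'.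
  by case: (between x x') => //; right; rewrite x'x.
exists (s1 ++ s2) => x Px; rewrite mem_cat; have [xx0|x0x|xx0] := ltgtP x x0.
- by rewrite s2P ?orbT.
- by rewrite s1P.
- by case: nP0; rewrite -xx0.
Qed.

(** A horizontal line through an interior point of a convex set leaves the
    interior at most once on each side, which bounds the exceptional points
    of that line by two. A line that meets the set but not its interior is at
    an extremal height: a point of the set strictly higher (seen from an
    interior point) would put an interior point on the line. So there are at
    most two such lines. *)
Lemma convex_slice_finite K : plane_convex K -> K° !=set0 ->
  exists Y : seq R, forall y, y \notin Y ->
    exists S : seq R, forall x, K (x, y) -> ~ K° (x, y) -> x \in S.
Proof.
move=> cK [[x0 y0] K0].
have [Y YP] : exists Y : seq R, forall y,
    ((exists x, K (x, y)) /\ forall x, ~ K° (x, y)) -> y \in Y.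
  apply: (@two_sided_list _ y0) => [[_ /(_ x0)]//|y y' /between_conv[t t01 yE]].
  move=> [[x' Kx'] _] [_ /(_ (t * x0 + (1 - t) * x'))]; apply.
  by rewrite yE; exact: (convex_interior cK K0 Kx' t01).
exists Y => y yY; have [[x1 K1]|n1] := pselect (exists x, K° (x, y)).
  have [S SP] : exists S : seq R, forall x,
      (K (x, y) /\ ~ K° (x, y)) -> x \in S.
    apply: (@two_sided_list _ x1) => [[]//|x x' /between_conv[t t01 xE]].
    move=> [Kx' _] [_]; apply.
    have := convex_interior cK K1 Kx' t01; rewrite /segpt /= -xE.
    by rewrite -mulrDl addrC subrK mul1r.
  by exists S => x Kx nKx; apply: SP.
exists [::] => x Kx nKx; move/negP: yY; case; apply: YP; split; first by exists x.
by move=> x' Kx'; apply: n1; exists x'.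
Qed.

End Convex.

(** * Geometry of the mesh *)

Section MeshGeometry.
Context {R : realType} {a b : R} {E : ref_element R} (M : mesh a b E).
Local Notation D := (square a b).

(** The inverse of an affine map, written as an affine map so that the lemmas
    on [affine_map] apply to it. *)
Definition affine_inv (A : 'M[R]_2) (t : R * R) : R * R -> R * R :=
  let B := invmx A in
  affine_map B (- (B 0 0 * t.1 + B 0 1 * t.2), - (B 1 0 * t.1 + B 1 1 * t.2)).

Lemma mx2_mulE (A B : 'M[R]_2) i j :
  (A *m B) i j = A i 0 * B 0 j + A i 1 * B 1 j.
Proof.
by rewrite !mxE !big_ord_recl big_ord0 addr0; congr (_ + A i _ * B _ j);
  apply/val_inj.
Qed.

Lemma affine_mapK A t : A \in unitmx ->
  cancel (affine_map A t) (affine_inv A t) /\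
  cancel (affine_inv A t) (affine_map A t).
Proof.
move=> uA; set B := invmx A.
have e i j : B i 0 * A 0 j + B i 1 * A 1 j = (i == j)%:R.
  by rewrite -mx2_mulE mulVmx// mxE.
have e' i j : A i 0 * B 0 j + A i 1 * B 1 j = (i == j)%:R.
  by rewrite -mx2_mulE mulmxV// mxE.
have [e00 e01 e10 e11] := And4 (e 0 0) (e 0 1) (e 1 0) (e 1 1).
have [f00 f01 f10 f11] := And4 (e' 0 0) (e' 0 1) (e' 1 0) (e' 1 1).
rewrite /= in e00 e01 e10 e11 f00 f01 f10 f11.
split=> -[x y]; rewrite /affine_inv -/B /affine_map /=; congr (_, _).
- transitivity ((B 0 0 * A 0 0 + B 0 1 * A 1 0) * x
    + (B 0 0 * A 0 1 + B 0 1 * A 1 1) * y); first by ring.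
  by rewrite e00 e01; ring.
- transitivity ((B 1 0 * A 0 0 + B 1 1 * A 1 0) * x
    + (B 1 0 * A 0 1 + B 1 1 * A 1 1) * y); first by ring.
  by rewrite e10 e11; ring.
- transitivity ((A 0 0 * B 0 0 + A 0 1 * B 1 0) * (x - t.1)
    + (A 0 0 * B 0 1 + A 0 1 * B 1 1) * (y - t.2) + t.1); first by ring.
  by rewrite f00 f01; ring.
- transitivity ((A 1 0 * B 0 0 + A 1 1 * B 1 0) * (x - t.1)
    + (A 1 0 * B 0 1 + A 1 1 * B 1 1) * (y - t.2) + t.2); first by ring.
  by rewrite f10 f11; ring.
Qed.

Lemma cell_convex k : plane_convex (cell M k).
Proof.
move=> _ _ t t01 [p Ep <-] [q Eq <-].
exists (segpt t p q); first exact: (convex_set_plane (@ref_dom_convex _ E)).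
by rewrite /cell_map /affine_map /segpt /=; congr (_, _); ring.
Qed.

Lemma affine_continuous A t : continuous (@affine_map R A t).
Proof.
have [c1c _ _ _] := c1_affine (A 0 0) (A 0 1) t.1.
have [c2c _ _ _] := c1_affine (A 1 0) (A 1 1) t.2.
by move=> p; exact: (cvg_pair (c1c p) (c2c p)).
Qed.

Lemma cell_interior k : (cell M k)° !=set0.
Proof.
have [p pE] := @ref_dom_interior _ E.
exists (cell_map M k p); rewrite /interior /=.
have [K1 K2] := affine_mapK (cell_shift k) (cell_mx_unit k).
have -> : cell M k = affine_inv (cell_mx k) (cell_shift k) @^-1` ref_dom E.
  apply/seteqP; split => [_ [q Eq <-]|q Eq].
    by rewrite /preimage /= /cell_map K1.
  by exists (affine_inv (cell_mx k) (cell_shift k) q); [exact: Eq|exact: K2].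
have cinv : continuous (affine_inv (cell_mx k) (cell_shift k)).
  exact: affine_continuous.
apply: (cinv (cell_map M k p)).
by rewrite [X in nbhs X]K1.
Qed.

Lemma cell_sub k : cell M k `<=` D.
Proof. by rewrite -(mesh_cover M); exact: bigcup_sup. Qed.

Lemma cell_interior_sub k : (cell M k)° `<=` D.
Proof. by move=> p /interior_subset; exact: cell_sub. Qed.

Lemma mesh_interiorP p : mesh_interior M p <-> exists k, (cell M k)° p.
Proof. by split => [[k _ kp]|[k kp]]; exists k. Qed.

(** The cells cover the square, so a point outside every cell interior is a
    non-interior point of one of the finitely many convex cells. *)
Lemma mesh_slice_finite : exists Y : seq R, forall y, y \notin Y ->
  exists S : seq R, forall x, D (x, y) -> x \notin S -> mesh_interior M (x, y).
Proof.
have /choice[Y YP] k :=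
  convex_slice_finite (@cell_convex k) (cell_interior k).
exists (flatten [seq Y k | k : 'I_(ncells M)]) => y yY.
have /choice[S SP] k : exists S : seq R, forall x, cell M k (x, y) ->
    ~ (cell M k)° (x, y) -> x \in S.
  apply: YP; apply: contra yY => yk.
  by apply/flatten_mapP; exists k; rewrite ?mem_enum.
exists (flatten [seq S k | k : 'I_(ncells M)]) => x; rewrite -(mesh_cover M) => -[k _ kx] xS.
apply/mesh_interiorP; exists k; apply: contrapT => nkx; move/negP: xS; apply.
by apply/flatten_mapP; exists k; rewrite ?mem_enum//; exact: SP.
Qed.

End MeshGeometry.

(** * Piecewise derivatives of finite element functions *)

Section FEFunctions.
Context {R : realType} {a b : R} {E : ref_element R} (M : mesh a b E).
Local Notation D := (square a b).
Local Notation Vh := (Vh M).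
Local Notation dx := (dx M).
Local Notation dy := (dy M).
Implicit Types (u v : R * R -> R).

Lemma open_mesh_interior : open (mesh_interior M).
Proof. by apply: bigcup_open => k _; exact: open_interior. Qed.

Lemma mesh_interior_sub : mesh_interior M `<=` D.
Proof. by move=> p [k _]; exact: cell_interior_sub. Qed.

Lemma near_hslice (A : set (R * R)) p : A° p -> \forall x \near p.1, A (x, p.2).
Proof.
move=> /plane_interiorP[r r0 rA]; apply/nbhs_ballP; exists r => //= x.
by rewrite -ball_normE /= distrC => px; apply: rA => //=; rewrite subrr normr0.
Qed.

Lemma near_vslice (A : set (R * R)) p : A° p -> \forall y \near p.2, A (p.1, y).
Proof.
move=> /plane_interiorP[r r0 rA]; apply/nbhs_ballP; exists r => //= y.
by rewrite -ball_normE /= distrC => py; apply: rA => //=; rewrite subrr normr0.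
Qed.

(** Pulling the reference polynomial back by the inverse of the affine cell
    map gives an extension of [v] from the cell to a [c1] function on the whole
    plane, so that derivatives inside a cell are restrictions of globally
    continuous functions. *)
Lemma Vh_cell v k : Vh v -> exists2 P, c1 P & {in cell M k, v =1 P}.
Proof.
move=> [_ _ _ /(_ k)[w wE vw]].
have [K1 _] := affine_mapK (cell_shift k) (cell_mx_unit k).
exists (w \o affine_inv (cell_mx k) (cell_shift k)).
  by apply: (c1_ref_space wE); exact: c1_affine.
by move=> q; rewrite inE => -[p Ep <-]; rewrite vw//= K1.
Qed.

Lemma is_derive_hslice v k P p : c1 P -> {in cell M k, v =1 P} ->
  (cell M k)° p -> is_derive p.1 1 (fun x => v (x, p.2)) (pdx P p).
Proof.
move=> [_ dP _ _] vP kp.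
apply: (@near_eq_is_derive _ _ _ (fun x => P (x, p.2))).
  by apply: filterS (near_hslice kp) => x kx; rewrite vP// inE.
by rewrite /pdx derive1E; apply: DeriveDef; first exact: dP.
Qed.

Lemma is_derive_vslice v k P p : c1 P -> {in cell M k, v =1 P} ->
  (cell M k)° p -> is_derive p.2 1 (fun y => v (p.1, y)) (pdy P p).
Proof.
move=> [_ _ dP _] vP kp.
apply: (@near_eq_is_derive _ _ _ (fun y => P (p.1, y))).
  by apply: filterS (near_vslice kp) => x kx; rewrite vP// inE.
by rewrite /pdy derive1E; apply: DeriveDef; first exact: dP.
Qed.

Lemma dx_cell v k P p : c1 P -> {in cell M k, v =1 P} -> (cell M k)° p ->
  dx v p = pdx P p.
Proof.
move=> cP vP kp; rewrite /Defs.dx patchE ifT; last first.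
  by rewrite inE; apply/mesh_interiorP; exists k.
by rewrite {1}/pdx derive1E; have [_ ->] := is_derive_hslice cP vP kp.
Qed.

Lemma dy_cell v k P p : c1 P -> {in cell M k, v =1 P} -> (cell M k)° p ->
  dy v p = pdy P p.
Proof.
move=> cP vP kp; rewrite /Defs.dy patchE ifT; last first.
  by rewrite inE; apply/mesh_interiorP; exists k.
by rewrite {1}/pdy derive1E; have [_ ->] := is_derive_vslice cP vP kp.
Qed.

Lemma dx_derive v p : Vh v -> mesh_interior M p ->
  is_derive p.1 1 (fun x => v (x, p.2)) (dx v p).
Proof.
move=> Vv /mesh_interiorP[k kp]; have [P cP vP] := Vh_cell k Vv.
by rewrite (dx_cell cP vP kp); exact: is_derive_hslice cP vP kp.
Qed.

Lemma dy_derive v p : Vh v -> mesh_interior M p ->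
  is_derive p.2 1 (fun y => v (p.1, y)) (dy v p).
Proof.
move=> Vv /mesh_interiorP[k kp]; have [P cP vP] := Vh_cell k Vv.
by rewrite (dy_cell cP vP kp); exact: is_derive_vslice cP vP kp.
Qed.

Lemma dx_out v p : ~ mesh_interior M p -> dx v p = 0.
Proof. by move=> np; rewrite /Defs.dx patchE memNset. Qed.

Lemma dy_out v p : ~ mesh_interior M p -> dy v p = 0.
Proof. by move=> np; rewrite /Defs.dy patchE memNset. Qed.

Lemma dxP k u v p : Vh u -> Vh v ->
  dx (fun q => k * u q + v q) p = k * dx u p + dx v p.
Proof.
move=> Vu Vv; have [ip|np] := pselect (mesh_interior M p); last first.
  by rewrite !dx_out// mulr0 addr0.
have Du := dx_derive Vu ip; have Dv := dx_derive Vv ip.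
have [_ Dval] : is_derive p.1 1 (fun x => k * u (x, p.2) + v (x, p.2))
    (k * dx u p + dx v p) by exact: (is_deriveD (is_deriveZ k Du) Dv).
by rewrite {1}/Defs.dx patchE mem_set// /pdx derive1E.
Qed.

Lemma dyP k u v p : Vh u -> Vh v ->
  dy (fun q => k * u q + v q) p = k * dy u p + dy v p.
Proof.
move=> Vu Vv; have [ip|np] := pselect (mesh_interior M p); last first.
  by rewrite !dy_out// mulr0 addr0.
have Du := dy_derive Vu ip; have Dv := dy_derive Vv ip.
have [_ Dval] : is_derive p.2 1 (fun y => k * u (p.1, y) + v (p.1, y))
    (k * dy u p + dy v p) by exact: (is_deriveD (is_deriveZ k Du) Dv).
by rewrite {1}/Defs.dy patchE mem_set// /pdy derive1E.
Qed.

(** The mesh interior is an open part of the square, so a derivative there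
    sees the values on the square only. *)
Lemma eq_dx u v : {in D, u =1 v} -> dx u = dx v.
Proof.
move=> uv; apply/funext => p.
have [ip|np] := pselect (mesh_interior M p); last by rewrite !dx_out.
rewrite /Defs.dx !patchE mem_set// /pdx !derive1E; apply: near_eq_derive.
have := open_mesh_interior; rewrite openE => /(_ _ ip).
move=> /near_hslice; apply: filterS => x ix; apply: uv.
by rewrite inE; exact: mesh_interior_sub.
Qed.

Lemma eq_dy u v : {in D, u =1 v} -> dy u = dy v.
Proof.
move=> uv; apply/funext => p.
have [ip|np] := pselect (mesh_interior M p); last by rewrite !dy_out.
rewrite /Defs.dy !patchE mem_set// /pdy !derive1E; apply: near_eq_derive.
have := open_mesh_interior; rewrite openE => /(_ _ ip).
move=> /near_vslice; apply: filterS => x ix; apply: uv.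
by rewrite inE; exact: mesh_interior_sub.
Qed.

Lemma dx_cst k : dx (fun=> k) = fun=> 0.
Proof.
apply/funext => p; rewrite /Defs.dx patchE; case: ifP => // _.
by rewrite /pdx derive1_cst.
Qed.

Lemma dy_cst k : dy (fun=> k) = fun=> 0.
Proof.
apply/funext => p; rewrite /Defs.dy patchE; case: ifP => // _.
by rewrite /pdy derive1_cst.
Qed.

(** As the cell interiors are disjoint, [g] is the sum of the continuous
    functions [P k] cut off to open sets. *)
Lemma bmeas_piecewise (g : R * R -> R) (P : 'I_(ncells M) -> R * R -> R) :
  (forall k, continuous (P k)) ->
  (forall k p, (cell M k)° p -> g p = P k p) ->
  (forall p, ~ mesh_interior M p -> g p = 0) -> bmeas a b g.
Proof.
move=> cP gP g0.
have -> : g = fun p => \sum_k (P k \_ (cell M k)°) p.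
  apply/funext => p; have [[k _ kp]|np] := pselect (mesh_interior M p).
    rewrite (bigD1 k)//= big1 ?addr0 ?patchE ?mem_set//; first exact: gP.
    move=> l lk; rewrite patchE memNset// => lp.
    by have := mesh_disjoint lk => /seteqP[/(_ p)] /(_ (conj lp kp)).
  rewrite g0// big1// => k _; rewrite patchE memNset// => kp; apply: np.
  by exists k.
elim: (index_enum _) => [|k r IH].
  have -> : (fun p => \sum_(i <- [::]) (P i \_ (cell M i)°) p) = fun=> 0.
    by apply/funext => p; rewrite big_nil.
  exact: bmeas_cst.
have -> : (fun p => \sum_(i <- k :: r) (P i \_ (cell M i)°) p) =
    fun p => (P k \_ (cell M k)°) p + \sum_(i <- r) (P i \_ (cell M i)°) p.
  by apply/funext => p; rewrite big_cons.
apply: bmeasD => //.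
have [mP [K PK]] : bmeas a b (P k).
  by apply: bmeas_within; exact: continuous_subspaceT.
have mk := @open_measurable2 R (cell M k)° (@open_interior _ _).
split.
  apply/(measurable_restrict _ mk); first exact: measurable_square.
  exact: measurable_funS (measurable_square _ _) (@subIsetl _ _ _) mP.
exists K => p Dp; rewrite patchE; case: ifP => _; first exact: PK.
by rewrite normr0 (le_trans _ (PK _ Dp)).
Qed.

Lemma bmeas_dx v : Vh v -> bmeas a b (dx v).
Proof.
move=> Vv; have /choice[P PP] k : exists P, c1 P /\ {in cell M k, v =1 P}.
  by have [P] := Vh_cell k Vv; exists P.
apply: (@bmeas_piecewise _ (fun k => pdx (P k))).
- by move=> k; have [[_ _ _ []]] := PP k.
- by move=> k p; apply: dx_cell; have [] := PP k.
- exact: dx_out.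
Qed.

Lemma bmeas_dy v : Vh v -> bmeas a b (dy v).
Proof.
move=> Vv; have /choice[P PP] k : exists P, c1 P /\ {in cell M k, v =1 P}.
  by have [P] := Vh_cell k Vv; exists P.
apply: (@bmeas_piecewise _ (fun k => pdy (P k))).
- by move=> k; have [[_ _ _ []]] := PP k.
- by move=> k p; apply: dy_cell; have [] := PP k.
- exact: dy_out.
Qed.

Lemma Vh_bmeas v : Vh v -> bmeas a b v.
Proof. by case=> cv _ _ _; exact: bmeas_within. Qed.

Lemma VhP k u v : Vh u -> Vh v -> Vh (fun p => k * u p + v p).
Proof.
move=> [cu xu yu pu] [cv xv yv pv]; split.
- move=> p; apply: cvgD; last exact: cv.
  by apply: cvgM; [exact: cvg_cst|exact: cu].
- by move=> y ?; rewrite xu// xv.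
- by move=> y ?; rewrite yu// yv.
move=> l; have [w [cw wE] uw] := pu l; have [w' [cw' wE'] vw'] := pv l.
exists (fun p => k * w p + w' p); last by move=> p Ep; rewrite uw// vw'.
exists (fun i => k * cw i + cw' i) => p.
rewrite wE wE' mulr_sumr -big_split; apply: eq_bigr => i _ /=.
by rewrite mulrDl mulrA.
Qed.

Lemma Vh0 : Vh (fun=> 0).
Proof.
split=> //; first by move=> p; exact: cvg_cst.
move=> k; exists (fun=> 0) => //; exists (fun=> 0) => p.
by rewrite big1// => i _; rewrite mul0r.
Qed.

Lemma VhB u v : Vh u -> Vh v -> Vh (fun p => u p - v p).
Proof.
move=> Vu Vv; have := VhP (-1) Vv Vu; congr Defs.Vh.
by apply/funext => p; rewrite mulN1r addrC.
Qed.

Lemma dx_hcontinuous v p : Vh v -> mesh_interior M p ->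
  {for p.1, continuous (fun x => dx v (x, p.2))}.
Proof.
move=> Vv /mesh_interiorP[k kp]; have [P cP vP] := Vh_cell k Vv.
have [_ _ _ [cPx _]] := cP.
have kpN : \forall x \near p.1, (cell M k)° (x, p.2).
  by apply: near_hslice; have := @open_interior _ (cell M k); rewrite openE; exact.
have e : dx v (p.1, p.2) = pdx P (p.1, p.2).
  by apply: (dx_cell cP vP); case: (p) kp.
change (dx v (x, p.2) @[x --> p.1] --> dx v (p.1, p.2)); rewrite e.
have : pdx P (x, p.2) @[x --> p.1] --> pdx P (p.1, p.2).
  have pr : (x, p.2) @[x --> p.1] --> (p.1, p.2).
    exact: (cvg_pair cvg_id (cvg_cst _)).
  exact: (cvg_comp _ _ pr (cPx _)).
apply: cvg_trans; apply: near_eq_cvg.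
by apply: filterS kpN => x kx; rewrite (dx_cell cP vP kx).
Qed.

End FEFunctions.

(** * Integration by parts *)

Section PiecewiseFTC.
Variable R : realType.

(** Induction on the exceptional list: an exceptional point inside [c, d]
    splits the interval, and on an interval without such points the mean value
    theorem applies. *)
Lemma const_off_finite (H : R -> R) (S : seq R) (c d : R) : c <= d ->
  {within `[c, d], continuous H} ->
  (forall x, x \in `]c, d[ -> x \notin S -> derivable H x 1 /\ 'D_1 H x = 0) -> H c = H d.
Proof.
elim: S c d => [|z S IH] c d; rewrite le_eqVlt => /predU1P[->//|cd] cH dH.
  have dH0 x : x \in `]c, d[ -> is_derive x 1 H (cst 0 x).
    by move=> xcd; have [] := dH x xcd; [|exact: DeriveDef].
  have [x _] := MVT cd dH0 cH.
  by rewrite mul0r => /eqP; rewrite subr_eq0 => /eqP.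
have [/[!in_itv]/= /andP[cz zd]|zcd] := boolP (z \in `]c, d[); last first.
  apply: IH => //; first exact: ltW.
  move=> x xcd xS; apply: dH => //; rewrite inE negb_or xS andbT.
  by apply: contra zcd => /eqP <-.
have sub l r : c <= l -> r <= d -> {within `[l, r], continuous H}.
  move=> cl rd; apply: continuous_subspaceW cH.
  by move=> x /=; rewrite !in_itv/= => /andP[? ?]; apply/andP; split; lra.
have Hcz : H c = H z.
  apply: (IH c z (ltW cz) (sub c z (lexx c) (ltW zd))).
  move=> x; rewrite in_itv/= => /andP[cx xz] xS; apply: dH.
    by rewrite in_itv/= cx (lt_trans xz).
  by rewrite inE negb_or xS lt_eqF.
rewrite Hcz; apply: (IH z d (ltW zd) (sub z d (ltW cz) (lexx d))).
move=> x; rewrite in_itv/= => /andP[zx xd] xS; apply: dH.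
  by rewrite in_itv/= xd (lt_trans cz).
by rewrite inE negb_or xS gt_eqF.
Qed.

Local Notation mu := (@lebesgue_measure R).

(** The difference between the indefinite integral of [g] and [F] is
    continuous and has zero derivative off the exceptional points. *)
Lemma FTC_off_finite (F g : R -> R) (S : seq R) (c d : R) : c < d ->
  mu.-integrable `[c, d] (EFin \o g) ->
  {within `[c, d], continuous F} ->
  (forall x, x \in `]c, d[ -> x \notin S ->
     is_derive x 1 F (g x) /\ {for x, continuous g}) ->
  \int[mu]_(x in `[c, d]) g x = F d - F c.
Proof.
move=> cd ig cF dF.
pose J := fun x => parameterized_integral mu c x g.
pose H := fun x => J x - F x.
have : H c = H d.
  apply: (@const_off_finite H S) => //; first exact: ltW.
    move=> x; apply: cvgB; last exact: cF.
    exact: (parameterized_integral_continuous (ltW cd) ig).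
  move=> x xcd xS; have [Fx gx] := dF x xcd xS.
  move: xcd; rewrite in_itv/= => /andP[cx xd].
  have [dJ] : derivable J x 1 /\ derive1 J x = g x.
    exact: (@continuous_FTC1 _ g (BLeft c) x d xd ig cx gx).
  rewrite derive1E => J'.
  have Jx : is_derive x 1 J (g x) := DeriveDef dJ J'.
  have [dH H'] := is_deriveB Jx Fx.
  by split=> //; rewrite -(subrr (g x)).
rewrite /H /J /parameterized_integral set_itv1 Rintegral_set1 => h.
by rewrite -[LHS](subrK (F d)) -h addrC sub0r.
Qed.

End PiecewiseFTC.

Section ByParts.
Context {R : realType} {a b : R} (ab : a < b) {E : ref_element R} (M : mesh a b E).
Local Notation D := (square a b).
Local Notation mu := (@lebesgue_measure R).

Lemma within_hslice (v : R * R -> R) (y : R) : {within D, continuous v} -> y \in `[a, b] ->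
  {within `[a, b], continuous (fun x => v (x, y))}.
Proof.
move=> /subspace_continuousP cv yab; apply/subspace_continuousP => x xab.
have Dxy : D (x, y) by [].
have pair_cvg : (z, y) @[z --> within `[a, b] (nbhs x)] -->
    within D (nbhs (x, y)).
  move=> A; change (nbhs (x, y) (fun q => D q -> A q) ->
    nbhs x (fun z => `[a, b]%classic z -> A (z, y))).
  move=> /nbhs_ballP[e /= e0 eA]; apply/nbhs_ballP; exists e => //= z xz zab.
  by apply: eA => //; split => //=; exact: ballxx.
exact: (cvg_comp _ _ pair_cvg (cv _ Dxy)).
Qed.

(** On such a line the integrand is the derivative of [v ^+ 2 / 2] off a
    finite set, and periodicity makes the boundary terms cancel. *)
Lemma hslice_integral v y : Vh M v -> y \in `[a, b] ->
  (exists S : seq R, forall x, D (x, y) -> x \notin S -> mesh_interior M (x, y)) ->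
  (\int[mu]_(x in `[a, b]) (v (x, y) * dx M v (x, y))%:E = 0)%E.
Proof.
move=> Vv yab [S SP].
have bh : bmeas a b (fun p => v p * dx M v p).
  by apply: bmeasM; [exact: Vh_bmeas Vv|exact: bmeas_dx].
pose g x := v (x, y) * dx M v (x, y).
have mg : measurable_fun `[a, b] g.
  have := bh.1; move/(measurable_restrictT _ (measurable_square a b)).
  move=> /(measurable_fun_pair1 y)/(measurable_funS measurableT (@subsetT _ `[a, b])).
  apply: eq_measurable_fun => x; rewrite inE => xab.
  by rewrite patchE mem_set.
have ig : mu.-integrable `[a, b] (EFin \o g).
  apply: measurable_bounded_integrable => //.
    by rewrite /= lebesgue_measure_itv/= lte_fin ab -EFinB ltry.
  have [_ [K gK]] := bh; exists K; split; first exact: num_real.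
  by move=> L KL x xab; apply: le_trans (ltW KL); exact: gK.
have : \int[mu]_(x in `[a, b]) g x = 0.
  pose F x := 2^-1 * (v (x, y) * v (x, y)).
  rewrite (@FTC_off_finite _ F g S)//.
  - rewrite /F; case: Vv => _ /(_ y) -> //.
    by rewrite subrr.
  - have cv : {within `[a, b], continuous (fun x => v (x, y))}.
      by apply: within_hslice => //; case: Vv.
    by move=> x; apply: cvgM; [exact: cvg_cst|apply: cvgM; exact: cv].
  move=> x xab xS.
  have ip : mesh_interior M (x, y).
    apply: SP => //; split=> //=.
    by move: xab; rewrite !in_itv/= => /andP[/ltW -> /ltW ->].
  have dv := dx_derive Vv ip; split.
    have -> : g x = 2^-1 * (v (x, y) * dx M v (x, y) + v (x, y) * dx M v (x, y)).
      by rewrite /g; field.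
    exact: is_deriveZ (is_deriveM dv dv).
  apply: cvgM; last exact: (dx_hcontinuous Vv ip).
  have [/derivable1_diffP/differentiable_continuous + _] := dv.
  exact.
rewrite /Rintegral => g0; rewrite -[LHS]fineK ?g0//.
exact: integrable_fin_num.
Qed.

(** This is integration by parts for a continuous, piecewise smooth, periodic
    function: by Fubini it suffices to integrate along horizontal lines, and
    all but finitely many of these meet the cell boundaries in a finite set. *)
Lemma inner_dx_self v : Vh M v -> inner a b v (dx M v) = 0.
Proof.
move=> Vv.
have bh : bmeas a b (fun p => v p * dx M v p).
  by apply: bmeasM; [exact: Vh_bmeas Vv|exact: bmeas_dx].
have ih := bmeas_integrable bh.
rewrite /inner /Rintegral integral_mkcond.
set f := (X in integral _ _ X).
have fi : mu2.-integrable setT f.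
  apply: (integrable_mkcond _ _).1 ih; exact: measurable_square.
rewrite -(integral21_prod_meas1 fi).
have [Y YP] := mesh_slice_finite M.
rewrite (ae_eq_integral (cst 0%E))//; first by rewrite integral0.
- exact: (measurable_fubini_G fi).
exists [set` Y]; split.
- by apply: countable_measurable => //; exact/finite_set_countable/finite_seq.
- by apply: countable_lebesgue_measure0; exact/finite_set_countable/finite_seq.
move=> y /= ny; apply: contrapT => /negP yY; apply: ny => _.
rewrite /fubini_G; have [yab|yab] := boolP (y \in `[a, b]); last first.
  apply: integral0_eq => x _; rewrite /f patchE memNset// => -[_ /= yab'].
  by move/negP: yab; exact.
rewrite -(hslice_integral Vv yab (YP _ yY)) [RHS]integral_mkcond.
apply: eq_integral => x _; rewrite /f !patchE.
have [xab|xab] := boolP (x \in `[a, b]).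
  by rewrite !mem_set.
rewrite !memNset//; first by move/negP: xab.
by move=> [xab' _]; move/negP: xab; exact.
Qed.

End ByParts.

(** * The mass matrix and the dispersive operator *)

Section Scheme.
Context {R : realType} {a b : R} (ab : a < b) {E : ref_element R} (M : mesh a b E).
Context {N : nat} (phi : 'I_N -> R * R -> R) (hphi : Vh_basis M phi).
Local Notation D := (square a b).
Local Notation Vh := (Vh M).
Local Notation dx := (dx M).
Local Notation dy := (dy M).
Local Notation fe := (fe_fun phi).
Local Notation bm := (bmeas a b).
Implicit Types (u v z s g : R * R -> R) (U V W : 'cV[R]_N).

Lemma feP k U V : fe (k *: U + V) = fun p => k * fe U p + fe V p.
Proof.
apply/funext => p; rewrite /fe_fun mulr_sumr -big_split; apply: eq_bigr => i _ /=.
by rewrite !mxE mulrDl mulrA.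
Qed.

Lemma fe0 : fe 0 = fun=> 0.
Proof. by apply/funext => p; rewrite /fe_fun big1// => i _; rewrite mxE mul0r. Qed.

Lemma Vh_sum (r : seq 'I_N) U : Vh (fun p => \sum_(i <- r) U i 0 * phi i p).
Proof.
elim: r => [|i r IH].
  by rewrite (_ : (fun p => _) = fun=> 0) ?funeqE => [|p]; [exact: Vh0|rewrite big_nil].
have -> : (fun p => \sum_(j <- i :: r) U j 0 * phi j p) =
    fun p => U i 0 * phi i p + \sum_(j <- r) U j 0 * phi j p.
  by apply/funext => p; rewrite big_cons.
by apply: VhP => //; exact: hphi.1.
Qed.

Lemma Vh_fe U : Vh (fe U).
Proof. exact: Vh_sum. Qed.

Lemma fe_eq0 U : (forall p, D p -> fe U p = 0) -> U = 0.
Proof.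
move=> U0; have [X [_ XU]] := hphi.2 _ (Vh0 M).
rewrite -(XU U); last by move=> p Dp; rewrite U0.
by apply: XU => p _; rewrite fe0.
Qed.

(** Reduces an identity that is linear in a finite element function to the
    shape functions, which is how the matrices of the scheme are read as
    bilinear forms. *)
Lemma linear_fe (T : (R * R -> R) -> R) U :
  (forall k u v, Vh u -> Vh v -> T (fun p => k * u p + v p) = k * T u + T v) ->
  T (fe U) = \sum_i U i 0 * T (phi i).
Proof.
move=> TP.
have T0 : T (fun=> 0) = 0.
  have E0 : T (fun=> 0) = -1 * T (fun=> 0) + T (fun=> 0).
    rewrite -[RHS](TP _ _ _ (Vh0 M) (Vh0 M)); congr T.
    by apply/funext => p; rewrite mulr0 addr0.
  by rewrite E0 mulN1r addNr.
rewrite /fe_fun; elim: (index_enum _) => [|i r IH].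
  rewrite big_nil -[RHS]T0; congr T.
  by apply/funext => p; rewrite big_nil.
rewrite big_cons -IH -TP; last 2 first.
- exact: hphi.1.
- exact: Vh_sum.
by congr T; apply/funext => p; rewrite big_cons.
Qed.

Lemma Vh_fe_exists v : Vh v -> exists U, {in D, v =1 fe U}.
Proof.
move=> /hphi.2[U [UE _]]; exists U => p; rewrite inE; exact: UE.
Qed.

Lemma linear_fe0 (T : (R * R -> R) -> R) s :
  (forall k u v, Vh u -> Vh v -> T (fun p => k * u p + v p) = k * T u + T v) ->
  (forall u v, {in D, u =1 v} -> T u = T v) ->
  (forall i, T (phi i) = 0) -> Vh s -> T s = 0.
Proof.
move=> TP Text T0 /Vh_fe_exists[U /Text ->]; rewrite linear_fe//.
by rewrite big1// => i _; rewrite T0 mulr0.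
Qed.

Lemma fe_const1 : partition_of_unity a b phi ->
  {in D, fe (const_mx 1) =1 (fun=> 1)}.
Proof.
move=> hone p; rewrite inE => Dp; rewrite /fe_fun -[RHS](hone p Dp).
by apply: eq_bigr => i _; rewrite mxE mul1r.
Qed.

Lemma bm_phi i : bm (phi i).
Proof. exact: Vh_bmeas (hphi.1 i). Qed.

Lemma bm_fe U : bm (fe U).
Proof. exact: Vh_bmeas (Vh_fe U). Qed.

Lemma mass_mx U i : (consistent_mass a b phi *m U) i 0 = inner a b (phi i) (fe U).
Proof.
rewrite mxE (@linear_fe (inner a b (phi i))); last first.
  by move=> k u v Vu Vv; apply: innerPr; [exact: Vh_bmeas Vu|exact: Vh_bmeas Vv|exact: bm_phi].
by apply: eq_bigr => j _; rewrite mxE mulrC.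
Qed.

Lemma mass_form U W :
  \sum_i W i 0 * (consistent_mass a b phi *m U) i 0 = inner a b (fe W) (fe U).
Proof.
rewrite inner_sym (@linear_fe (inner a b (fe U))); last first.
  move=> k u v Vu Vv; apply: innerPr; [exact: Vh_bmeas Vu|exact: Vh_bmeas Vv|].
  exact: Vh_bmeas (Vh_fe U).
by apply: eq_bigr => i _; rewrite mass_mx inner_sym.
Qed.

(** The row sums are obtained by testing with the constant function, which is
    the sum of the shape functions. *)
Lemma mass_total U : partition_of_unity a b phi ->
  \sum_i (consistent_mass a b phi *m U) i 0 = \sum_i U i 0 * mass a b phi i.
Proof.
move=> hone.
have fe1 := fe_const1 hone.
transitivity (inner a b (fe (const_mx 1)) (fe U)).
  by rewrite -mass_form; apply: eq_bigr => i _; rewrite [const_mx _ _ _]mxE mul1r.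
rewrite (@linear_fe (inner a b (fe (const_mx 1)))); last first.
  move=> k u v Vu Vv; apply: innerPr; [exact: Vh_bmeas Vu|exact: Vh_bmeas Vv|].
  exact: bm_fe.
apply: eq_bigr => i _; congr (_ * _); rewrite /mass.
by apply: eq_Rintegral => p Dp; rewrite fe1// mul1r.
Qed.

Section Dispersive.
Variables (eps c : R) (eps0 : 0 < eps) (c0 : 0 < c).
Local Notation aux := (aux M c).
Local Notation aux_eq := (aux_eq M c).

(* the test functions of the auxiliary problems *)
Let tst s : R * R -> R := fun p => c * s p - dx s p.

Lemma tstP k u v : Vh u -> Vh v ->
  tst (fun p => k * u p + v p) = fun p => k * tst u p + tst v p.
Proof. by move=> Vu Vv; apply/funext => p; rewrite /tst dxP//; ring. Qed.

Lemma bm_tst s : Vh s -> bm (tst s).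
Proof.
by move=> Vs; apply: bmeasB; [apply: bmeasZ; exact: Vh_bmeas Vs|exact: bmeas_dx].
Qed.

Lemma inner_tst_linear g : bm g -> forall k u v, Vh u -> Vh v ->
  inner a b g (tst (fun p => k * u p + v p)) =
  k * inner a b g (tst u) + inner a b g (tst v).
Proof.
by move=> bg k u v Vu Vv; rewrite tstP// innerPr//; exact: bm_tst.
Qed.

Lemma inner_tst_ext g u v : {in D, u =1 v} ->
  inner a b g (tst u) = inner a b g (tst v).
Proof.
by move=> uv; apply: eq_inner => // p Dp; rewrite /tst uv// (eq_dx M uv).
Qed.

(** The derivative part of the test function contributes nothing by periodicity,
    which leaves [c] times the squared norm of [z]. *)
Lemma tst_definite z : Vh z -> inner a b z (tst z) = 0 ->
  forall p, D p -> z p = 0.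
Proof.
move=> Vz; have bz := Vh_bmeas Vz; have bdz := bmeas_dx Vz.
have -> : inner a b z (tst z) = c * inner a b z z.
  by rewrite innerBr ?innerZr ?inner_dx_self ?subr0//; exact: bmeasZ.
move/eqP; rewrite mulf_eq0 gt_eqF//= => /eqP; apply: inner_eq0 => //.
by case: Vz.
Qed.

Lemma aux_eqE g z : bm g -> Vh z -> aux_eq g z <->
  forall s, Vh s -> inner a b z (tst s) = inner a b g (tst s).
Proof.
move=> bg Vz; have bz := Vh_bmeas Vz; split.
  move=> [_ zE] s Vs; apply/eqP; rewrite -subr_eq0; apply/eqP.
  by rewrite -innerBl//; [exact: zE|exact: bm_tst].
move=> zE; split=> // s Vs; rewrite innerBl//; last exact: bm_tst.
by rewrite zE// subrr.
Qed.

Lemma aux_eq_unique g z z' : bm g -> aux_eq g z -> aux_eq g z' ->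
  {in D, z =1 z'}.
Proof.
move=> bg zg zg'; have [Vz _] := zg; have [Vz' _] := zg'.
move/(aux_eqE bg Vz) : zg => zg; move/(aux_eqE bg Vz') : zg' => zg'.
have Vd := VhB Vz Vz'.
have d0 := tst_definite Vd; move=> p; rewrite inE => Dp.
apply/eqP; rewrite -subr_eq0; apply/eqP; apply: d0 => //.
rewrite innerBl; [|exact: Vh_bmeas Vz|exact: Vh_bmeas Vz'|exact: bm_tst].
by rewrite zg// zg'// subrr.
Qed.

(** By [tst_definite] the square linear system for the coefficients of the
    solution is injective. *)
Lemma aux_eq_exists g : bm g -> exists z, aux_eq g z.
Proof.
move=> bg.
pose L U : 'cV[R]_N := \col_i inner a b (fe U) (tst (phi i)).
have bphi i : bm (tst (phi i)) by apply: bm_tst; exact: hphi.1.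
have bfe U : bm (fe U) by exact: Vh_bmeas (Vh_fe U).
have Llin k U V : L (k *: U + V) = k *: L U + L V.
  by apply/matrixP => i j; rewrite !mxE feP innerPl.
have Linj U : L U = 0 -> U = 0.
  move=> /matrixP LU; apply: fe_eq0; apply: tst_definite; first exact: Vh_fe.
  apply: (@linear_fe0 (fun s => inner a b (fe U) (tst s))).
  - exact: inner_tst_linear.
  - by move=> *; exact: inner_tst_ext.
  - by move=> i; have := LU i 0; rewrite !mxE.
  - exact: Vh_fe.
have [U [LU _]] := linear_inj_bij Llin Linj (\col_i inner a b g (tst (phi i))).
exists (fe U); apply/aux_eqE => //; first exact: Vh_fe.
move=> s Vs; apply/eqP; rewrite -subr_eq0; apply/eqP.
rewrite -innerBl//; last exact: bm_tst.
have bh : bm (fun p => fe U p - g p) by exact: bmeasB.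
refine (@linear_fe0 (fun s' => inner a b _ (tst s')) s (inner_tst_linear bh) _ _ Vs).
- by move=> u v uv; exact: inner_tst_ext.
- move=> i; rewrite innerBl//.
  by move/matrixP : LU => /(_ i 0); rewrite !mxE => ->; rewrite subrr.
Qed.

Lemma auxE g : bm g -> aux_eq g (aux g).
Proof. by move=> /aux_eq_exists[z zg]; exact: xgetPex (ex_intro _ z zg). Qed.

Lemma Vh_aux g : bm g -> Vh (aux g).
Proof. by move=> /auxE[]. Qed.

(** By uniqueness: the right-hand side solves the auxiliary problem. The
    equality holds on the square only, since [aux] is a choice among functions
    on the plane. *)
Lemma auxP k g g' : bm g -> bm g' ->
  {in D, aux (fun p => k * g p + g' p) =1 (fun p => k * aux g p + aux g' p)}.
Proof.
move=> bg bg'; have bgg : bm (fun p => k * g p + g' p).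
  by apply: bmeasD => //; exact: bmeasZ.
have [Vz Vz'] := (Vh_aux bg, Vh_aux bg').
apply: (aux_eq_unique bgg (auxE bgg)).
apply/aux_eqE => //; first exact: VhP.
move=> s Vs; have bs := bm_tst Vs.
rewrite innerPl; [|exact: Vh_bmeas Vz|exact: Vh_bmeas Vz'|by []].
rewrite innerPl//.
by rewrite (aux_eqE bg Vz).1 ?(aux_eqE bg' Vz').1//; exact: auxE.
Qed.

(** Testing the auxiliary problem with its own solution [z], and using that
    [z] is orthogonal to its derivative, gives
    [c * (z - g, z) = - (dx z, g)]. Subtracting [c * (z - g, g)] from both
    sides turns the left one into [c * (z - g, z - g)]. *)
Lemma aux_energy g : bm g ->
  inner a b (dx (aux g)) g + c * inner a b (fun p => aux g p - g p) g =
  - (c * inner a b (fun p => aux g p - g p) (fun p => aux g p - g p)).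
Proof.
move=> bg; have [Vz] := auxE bg; set z := aux g in Vz *.
move=> /(_ z Vz) zE; have bz := Vh_bmeas Vz; have bdz := bmeas_dx Vz.
have bX : bm (fun p => z p - g p) by exact: bmeasB.
set X := fun p => z p - g p in bX zE *.
have XX : inner a b X X = inner a b X z - inner a b X g by rewrite innerBr.
have Xz : c * inner a b X z = inner a b X (dx z).
  apply/eqP; rewrite -subr_eq0; apply/eqP; rewrite -innerZr// -innerBr//.
  exact: bmeasZ.
have Xdz : inner a b X (dx z) = - inner a b (dx z) g.
  by rewrite innerBl// inner_dx_self// sub0r inner_sym.
by rewrite XX mulrBr Xz Xdz opprB opprK addrC.
Qed.

(** Two instances of [aux_energy] identify the form at [(u, u)] with
    [eps * c] times the sum of the squared norms of the residuals
    [z - dx u] and [q - dy u]. *)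
Lemma disp_form_ge0 u : Vh u -> 0 <= disp_form M eps c u u.
Proof.
move=> Vu; have [bdx bdy] := (bmeas_dx Vu, bmeas_dy Vu).
have ex := aux_energy bdx; have ey := aux_energy bdy.
have algebra A B X Y XX YY : A + c * X = - (c * XX) -> B + c * Y = - (c * YY) ->
    0 <= XX -> 0 <= YY -> 0 <= - (eps * A) - eps * B - eps * c * X - eps * c * Y.
  move=> eA eB XX0 YY0.
  have -> : - (eps * A) - eps * B - eps * c * X - eps * c * Y =
    - (eps * (A + c * X)) - eps * (B + c * Y) by ring.
  rewrite eA eB; have -> : - (eps * - (c * XX)) - eps * - (c * YY) =
    eps * c * (XX + YY) by ring.
  by rewrite mulr_ge0 ?addr_ge0// mulr_ge0// ltW.
exact: (algebra _ _ _ _ _ _ ex ey (inner_ge0 _ _ _) (inner_ge0 _ _ _)).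
Qed.

(** [disp_form] is linear in either argument as soon as each of its four
    inner products is. *)
Lemma disp_combination k (l1 l2 l3 l4 m1 m2 m3 m4 n1 n2 n3 n4 : R) :
  l1 = k * m1 + n1 -> l2 = k * m2 + n2 ->
  l3 = k * m3 + n3 -> l4 = k * m4 + n4 ->
  - (eps * l1) - eps * l2 - eps * c * l3 - eps * c * l4 =
  k * (- (eps * m1) - eps * m2 - eps * c * m3 - eps * c * m4)
  + (- (eps * n1) - eps * n2 - eps * c * n3 - eps * c * n4).
Proof. by move=> -> -> -> ->; ring. Qed.

Lemma residual_combination (k z zv zw gv gw : R) : z = k * zv + zw ->
  z - (k * gv + gw) = k * (zv - gv) + (zw - gw).
Proof. by move=> ->; ring. Qed.

Lemma disp_form_linear_r u k v w : Vh u -> Vh v -> Vh w ->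
  disp_form M eps c u (fun p => k * v p + w p) =
  k * disp_form M eps c u v + disp_form M eps c u w.
Proof.
move=> Vu Vv Vw; have [bdx bdy] := (bmeas_dx Vu, bmeas_dy Vu).
have [Vz Vq] := (Vh_aux bdx, Vh_aux bdy).
have [bvx bvy] := (bmeas_dx Vv, bmeas_dy Vv).
have [bwx bwy] := (bmeas_dx Vw, bmeas_dy Vw).
have [bz bq] := (bmeas_dx Vz, bmeas_dx Vq).
have bX := bmeasB (Vh_bmeas Vz) bdx; have bY := bmeasB (Vh_bmeas Vq) bdy.
rewrite /disp_form.
have -> : dx (fun p => k * v p + w p) = fun p => k * dx v p + dx w p.
  by apply/funext => p; exact: dxP.
have -> : dy (fun p => k * v p + w p) = fun p => k * dy v p + dy w p.
  by apply/funext => p; exact: dyP.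
exact: disp_combination (innerPr k bvx bwx bz) (innerPr k bvy bwy bq)
  (innerPr k bvx bwx bX) (innerPr k bvy bwy bY).
Qed.

Lemma disp_form_linear_l u k v w : Vh u -> Vh v -> Vh w ->
  disp_form M eps c (fun p => k * v p + w p) u =
  k * disp_form M eps c v u + disp_form M eps c w u.
Proof.
move=> Vu Vv Vw; have [bdx bdy] := (bmeas_dx Vu, bmeas_dy Vu).
have [bvx bvy] := (bmeas_dx Vv, bmeas_dy Vv).
have [bwx bwy] := (bmeas_dx Vw, bmeas_dy Vw).
rewrite /disp_form.
have -> : dx (fun p => k * v p + w p) = fun p => k * dx v p + dx w p.
  by apply/funext => p; exact: dxP.
have -> : dy (fun p => k * v p + w p) = fun p => k * dy v p + dy w p.
  by apply/funext => p; exact: dyP.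
have auxX := auxP k bvx bwx; have auxY := auxP k bvy bwy.
have [Vzv Vzw] := (Vh_aux bvx, Vh_aux bwx).
have [Vqv Vqw] := (Vh_aux bvy, Vh_aux bwy).
have dX : dx (aux (fun p => k * dx v p + dx w p)) =
    fun p => k * dx (aux (dx v)) p + dx (aux (dx w)) p.
  by apply: etrans (eq_dx M auxX) _; apply/funext => p; exact: dxP.
have dY : dx (aux (fun p => k * dy v p + dy w p)) =
    fun p => k * dx (aux (dy v)) p + dx (aux (dy w)) p.
  by apply: etrans (eq_dx M auxY) _; apply/funext => p; exact: dxP.
have bzv := bmeas_dx Vzv; have bzw := bmeas_dx Vzw.
have bqv := bmeas_dx Vqv; have bqw := bmeas_dx Vqw.
have eX : inner a b (fun p => aux (fun q => k * dx v q + dx w q) p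
      - (k * dx v p + dx w p)) (dx u) =
    k * inner a b (fun p => aux (dx v) p - dx v p) (dx u) +
    inner a b (fun p => aux (dx w) p - dx w p) (dx u).
  have bXv := bmeasB (Vh_bmeas Vzv) bvx; have bXw := bmeasB (Vh_bmeas Vzw) bwx.
  rewrite -[RHS](innerPl k bXv bXw bdx).
  by apply: eq_inner => [p Dp|//]; exact: residual_combination (auxX p Dp).
have eY : inner a b (fun p => aux (fun q => k * dy v q + dy w q) p
      - (k * dy v p + dy w p)) (dy u) =
    k * inner a b (fun p => aux (dy v) p - dy v p) (dy u) +
    inner a b (fun p => aux (dy w) p - dy w p) (dy u).
  have bYv := bmeasB (Vh_bmeas Vqv) bvy; have bYw := bmeasB (Vh_bmeas Vqw) bwy.
  rewrite -[RHS](innerPl k bYv bYw bdy).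
  by apply: eq_inner => [p Dp|//]; exact: residual_combination (auxY p Dp).
have eZ := etrans (congr1 (fun h => inner a b h (dx u)) dX)
  (innerPl k bzv bzw bdx).
have eQ := etrans (congr1 (fun h => inner a b h (dy u)) dY)
  (innerPl k bqv bqw bdy).
exact: disp_combination eZ eQ eX eY.
Qed.

Lemma disp_linear k U V :
  disp M phi eps c (k *: U + V) = k *: disp M phi eps c U + disp M phi eps c V.
Proof.
have h i := disp_form_linear_l k (hphi.1 i) (Vh_fe U) (Vh_fe V).
rewrite /disp feP; apply/matrixP => i j; rewrite [LHS]mxE.
rewrite [RHS]mxE [X in _ = X + _]mxE [X in _ = _ * X + _]mxE.
rewrite [X in _ = _ + X]mxE; exact: h.
Qed.

Lemma disp_formE U W :
  \sum_i W i 0 * disp M phi eps c U i 0 = disp_form M eps c (fe U) (fe W).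
Proof.
rewrite (@linear_fe (disp_form M eps c (fe U))).
  by apply: eq_bigr => i _; rewrite mxE.
by move=> k u v Vu Vv; apply: disp_form_linear_r => //; exact: Vh_fe.
Qed.

(** Summing over the shape functions tests the operator with the constant 1,
    and each of its terms contains a derivative of the test function. *)
Lemma disp_total U : partition_of_unity a b phi ->
  \sum_i disp M phi eps c U i 0 = 0.
Proof.
move=> hone.
have fe1 := fe_const1 hone.
transitivity (disp_form M eps c (fe U) (fe (const_mx 1))).
  by rewrite -disp_formE; apply: eq_bigr => i _; rewrite [const_mx _ _ _]mxE mul1r.
rewrite /disp_form (eq_dx M fe1) (eq_dy M fe1) dx_cst dy_cst.
have inner0r w : inner a b w (fun=> 0) = 0 by rewrite inner_sym inner0l.
have algebra (A B X Y : R) : A = 0 -> B = 0 -> X = 0 -> Y = 0 ->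
    - (eps * A) - eps * B - eps * c * X - eps * c * Y = 0.
  by move=> -> -> -> ->; ring.
exact: (algebra _ _ _ _ (inner0r _) (inner0r _) (inner0r _) (inner0r _)).
Qed.

(** Energy estimate: a solution of the homogeneous equation satisfies
    [(u, u) + tau * (G u, u) = 0] with both terms nonnegative, so [u] vanishes
    on the square. *)
Lemma implicit_bij tau : 0 < tau -> forall B : 'cV[R]_N,
  exists! X, consistent_mass a b phi *m X + tau *: disp M phi eps c X = B.
Proof.
move=> tau0; apply: linear_inj_bij.
  move=> k U V; rewrite disp_linear mulmxDr -scalemxAr !scalerDr !scalerA.
  by rewrite addrACA (mulrC tau).
move=> U /matrixP U0; apply: fe_eq0; apply: inner_eq0 => //.
  by have [] := Vh_fe U.
have : \sum_i U i 0 * (consistent_mass a b phi *m U + tau *: disp M phi eps c U) i 0 = 0.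
  by rewrite big1// => i _; rewrite U0 mxE mulr0.
have -> : \sum_i U i 0 * (consistent_mass a b phi *m U + tau *: disp M phi eps c U) i 0
   = inner a b (fe U) (fe U) + tau * disp_form M eps c (fe U) (fe U).
  rewrite -mass_form -disp_formE mulr_sumr -big_split; apply: eq_bigr => i _ /=.
  by rewrite [in LHS]mxE [in X in _ * (_ + X)]mxE; ring.
have := disp_form_ge0 (Vh_fe U); have := inner_ge0 a b (fe U).
move=> i0 d0 /eqP; rewrite paddr_eq0//; last by rewrite mulr_ge0// ltW.
by move=> /andP[/eqP].
Qed.

End Dispersive.
End Scheme.

(** * The scheme *)

Section Masses.
Context {R : realType} {a b : R} (ab : a < b) {E : ref_element R} (M : mesh a b E).
Context {N : nat} (phi : 'I_N -> R * R -> R).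

Lemma mulmx_bij (F : fieldType) n (A : 'M[F]_n) :
  (forall u : 'cV_n, A *m u = 0 -> u = 0) -> forall w : 'cV_n, exists! u, A *m u = w.
Proof.
by apply: linear_inj_bij => k u v; rewrite mulmxDr scalemxAr.
Qed.

Lemma lumped_mass_bij : (forall i, 0 < mass a b phi i) ->
  forall w : 'cV_N, exists! u, lumped_mass a b phi *m u = w.
Proof.
move=> m0; apply: mulmx_bij => u /matrixP mu; apply/matrixP => i j.
have := mu i j; rewrite mul_diag_mx !mxE => /eqP.
by rewrite mulf_eq0 gt_eqF//= => /eqP.
Qed.

Lemma consistent_mass_bij : Vh_basis M phi ->
  forall w : 'cV_N, exists! u, consistent_mass a b phi *m u = w.
Proof.
move=> hphi; apply: mulmx_bij => u Mu; apply: (fe_eq0 hphi).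
apply: inner_eq0 => //; first by have [] := Vh_fe hphi u.
by rewrite -(mass_form hphi) Mu big1// => i _; rewrite mxE mulr0.
Qed.

End Masses.

Theorem theorem4p5 (R : realType) (a b : R) (hab : a < b)
  (f : R -> R * R) (hf : lipschitz f)
  (eps c : R) (heps : 0 < eps) (hc : 0 < c)
  (E : ref_element R) (M : mesh a b E)
  (N : nat) (phi : 'I_N -> R * R -> R)
  (hphi : Vh_basis M phi) (hone : partition_of_unity a b phi)
  (hmass : forall i, 0 < mass a b phi i)
  (lam : R * R -> R -> R -> R)
  (hlam : forall (n : R * R) (UL UR : R), norm2 n = 1 ->
     wave_speed_bound (fun u => dot (f u) n) UL UR (lam n UL UR))
  (psi : 'cV[R]_N -> 'I_N -> R) (hpsi : forall U k, 0 < psi U k)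
  (s : nat) (hs : (2 <= s)%N) (T : imex_tableau R s)
  (Un : 'cV[R]_N) (tau : R) (htau0 : 0 < tau)
  (htau : (tau%:E <= tau_star M phi lam Un / (dc_max T)%:E)%E)
  (ell : R -> R -> 'cV[R]_N -> 'cV[R]_N -> 'cV[R]_N -> 'cV[R]_N) :
  let m := mass a b phi in
  let ML := lumped_mass a b phi in
  let MH := consistent_mass a b phi in
  let FL := hyp_flux M phi f (visc M phi lam) in
  let FH := hyp_flux M phi f (visc_high M phi lam psi) in
  let G := disp M phi eps c in
  limiter m ML tau FL FH ell ->
  (forall (l : nat), (2 <= l <= s.+1)%N ->
   forall (U : nat -> 'cV[R]_N), U 1%N = Un ->
   forall al be : R, in_box al be (U l.-1) ->
     exists! X : 'cV[R]_N * 'cV[R]_N * 'cV[R]_N * 'cV[R]_N,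
       let: (WL, WH, W, Ul) := X in
       imex_stage T ML MH FL FH G (ell al be) tau l U WL WH W Ul)
  /\
  (forall (U WL WH W : nat -> 'cV[R]_N) (al be : nat -> R),
     U 1%N = Un ->
     (forall l, (2 <= l <= s.+1)%N ->
        in_box (al l) (be l) (U l.-1) /\
        imex_stage T ML MH FL FH G (ell (al l) (be l)) tau l U
          (WL l) (WH l) (W l) (U l)) ->
     \sum_i U s.+1 i 0 * m i = \sum_i Un i 0 * m i).
Proof.
move=> m ML MH FL FH G hell; split.
  move=> l _ U _ al be _.
  set W := ell al be (U l.-1) (FL (U l.-1)) (FH (U l.-1)).
  have [WL [eWL uWL]] := lumped_mass_bij hmass (ML *m U l.-1
    - (tau * (node T l - node T l.-1)) *: FL (U l.-1)).
  have [WH [eWH uWH]] := consistent_mass_bij hab hphi (MH *m U l.-1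
    - tau *: \sum_(1 <= k < l) (ae T l k - ae T l.-1 k) *: FH (U k)).
  have [Ul [eUl uUl]] := implicit_bij hab hphi heps hc htau0 (MH *m W
    - tau *: \sum_(1 <= k < l) (ai T l k - ai T l.-1 k) *: G (U k)).
  exists (WL, WH, W, Ul); split; first by split.
  move=> [[[WL' WH'] W'] Ul'] [/uWL -> /uWH -> -> eUl'].
  by rewrite (uUl _ eUl').
move=> U WL WH W al be U1 hst.
pose total (X : 'cV[R]_N) := \sum_i X i 0.
have totalP k X Y : total (k *: X + Y) = k * total X + total Y.
  by rewrite /total mulr_sumr -big_split; apply: eq_bigr => i _ /=; rewrite !mxE.
have totalG X : total (G X) = 0 by exact: disp_total.
have totalS (r : seq nat) (k : nat -> R) :
    total (\sum_(i <- r) k i *: G (U i)) = 0.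
  elim: r => [|i r IH]; last by rewrite big_cons totalP totalG IH mulr0 addr0.
  by rewrite big_nil /total big1// => i _; rewrite mxE.
have step l : (2 <= l <= s.+1)%N ->
    \sum_i U l i 0 * m i = \sum_i U l.-1 i 0 * m i.
  move=> /hst[box [_ _ WE UE]].
  rewrite -(hell _ _ _ box).2 -WE -!(mass_total hphi _ hone).
  have : total (tau *: G (U l) + MH *m U l) = total (- tau *: \sum_(1 <= k < l)
      (ai T l k - ai T l.-1 k) *: G (U k) + MH *m W l).
    by rewrite addrC UE addrC scaleNr.
  by rewrite !totalP totalG totalS !mulr0 !add0r.
have conserve l : (1 <= l <= s.+1)%N ->
    \sum_i U l i 0 * m i = \sum_i Un i 0 * m i.
  elim: l => // l IH /andP[_ ls]; case: l IH ls => [_ _|l IH ls].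
    by rewrite U1.
  rewrite step; last by rewrite ls.
  by apply: IH; rewrite (ltnW ls).
by apply: conserve; rewrite leqnn.
Qed.
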